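(* Let $G$ be a unipotent algebraic group over $\mathbb{C}$ and let $J$ be a Hopf $2$-cocycle for $G$. Then the Hopf algebra ${}_J\mathcal{O}(G)_J$ is an affine (i.e. finitely generated) Noetherian domain with Gelfand-Kirillov dimension $\dim(G)$.
   Context: For an affine algebraic group $G$ over $\mathbb{C}$, $\mathcal{O}(G)$ is its coordinate Hopf algebra, with Sweedler notation $\Delta(a)=\sum a_1\otimes a_2$ and counit $\varepsilon$. A Hopf $2$-cocycle for $G$ is a linear form $J:\mathcal{O}(G)\otimes\mathcal{O}(G)\to\mathbb{C}$ that has an inverse $J^{-1}$ for the convolution product $(f*h)(a,b)=\sum f(a_1,b_1)h(a_2,b_2)$ and satisfies $\sum J(a_1b_1,c)J(a_2,b_2)=\sum J(a,b_1c_1)J(b_2,c_2)$ and $J(a,1)=\varepsilon(a)=J(1,a)$ for all $a,b,c$. The Hopf algebra ${}_J\mathcal{O}(G)_J$ equals $\mathcal{O}(G)$ as a coalgebra and has multiplication $a\otimes b\mapsto \sum J^{-1}(a_1,b_1)\,a_2b_2\,J(a_3,b_3)$. *)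

(* Defs.v *)
From HB Require Import structures.
From mathcomp Require Import all_boot all_order all_algebra.
From mathcomp Require Import all_classical all_reals all_analysis.
From mathcomp Require Import complex.

Set Implicit Arguments.
Unset Strict Implicit.
Unset Printing Implicit Defensive.

Import Order.TTheory GRing.Theory Num.Theory.

Local Open Scope classical_set_scope.
Local Open Scope ring_scope.

(* The elements v of V in the linear span of the finite family s. *)
Definition in_span (K : fieldType) (V : lmodType K) (s : seq V) (v : V) : Prop :=
  exists c : 'I_(size s) -> K, v = \sum_(i < size s) c i *: s`_i.

(* The dimension of that span, which lives in a possibly infinite-dimensional
   V: the largest size of a linearly independent subfamily of s. *)
Definition span_dim (K : fieldType) (V : lmodType K) (s : seq V) : nat :=
  \max_(I : {set 'I_(size s)} |
        `[< forall c : 'I_(size s) -> K,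
              \sum_(i in I) c i *: s`_i = 0 -> forall i, i \in I -> c i = 0 >])
    #|I|.

(* The products of at most n elements of s, so that words s n spans
   \sum_(i <= n) W ^ i when s spans W. *)
Fixpoint words (A : nzRingType) (s : seq A) (n : nat) : seq A :=
  if n is m.+1 then 1 :: [seq x * w | x <- s, w <- words s m] else [:: 1].

Definition finitely_generated (K : fieldType) (A : algType K) : Prop :=
  exists s : seq A, forall a : A, exists n, in_span (words s n) a.

Definition left_ideal (A : nzRingType) (I : set A) : Prop :=
  [/\ I 0, forall x y, I x -> I y -> I (x + y) & forall a x, I x -> I (a * x)].

Definition right_ideal (A : nzRingType) (I : set A) : Prop :=
  [/\ I 0, forall x y, I x -> I y -> I (x + y) & forall a x, I x -> I (x * a)].

Definition acc (A : Type) (P : set A -> Prop) : Prop :=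
  forall I : nat -> set A,
    (forall n, P (I n)) -> (forall n, I n `<=` I n.+1) ->
    exists N, forall n, (N <= n)%N -> I n = I N.

Definition noetherian (A : nzRingType) : Prop :=
  acc (@left_ideal A) /\ acc (@right_ideal A).

Definition is_domain (A : nzRingType) : Prop :=
  forall a b : A, a * b = 0 -> a = 0 \/ b = 0.

(* sup over the finite-dimensional subspaces W of A of
   limsup_n log_n (dim (\sum_(i <= n) W ^ i)). *)
Definition GKdim (R : realType) (K : fieldType) (A : algType K) : \bar R :=
  ereal_sup (range (fun s : seq A =>
    limn_esup (fun n : nat =>
      (ln (span_dim (words s n))%:R / ln n%:R : R)%:E))).

(* An affine algebraic group over an algebraically closed field: a group G with
   a finitely generated algebra O(G) of functions on it such that the algebra
   morphisms O(G) -> K are exactly the evaluations at the points of G, and such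
   that (x, y) |-> f (x * y) lies in O(G) (x) O(G), and x |-> f x^-1 in O(G),
   for all f in O(G).  The value of f at x is ev x f. *)
Record affAlgGroup (K : closedFieldType) := AffAlgGroup {
  points :> groupType;
  coord : comAlgType K;
  ev : points -> {lrmorphism coord -> K^o};
  coord_ext : forall f g : coord, (forall x, ev x f = ev x g) -> f = g;
  ev_inj : forall x y : points, ev x =1 ev y -> x = y;
  ev_surj : forall phi : {lrmorphism coord -> K^o}, exists x, phi =1 ev x;
  coord_fg : finitely_generated coord;
  coord_mul : forall f : coord, exists s : seq (coord * coord),
    forall x y, ev (x * y)%g f = \sum_(p <- s) ev x p.1 * ev y p.2;
  coord_inv : forall f : coord, exists g : coord, forall x, ev x g = ev x^-1%g f
}.

Arguments coord {K} G : rename.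
Arguments ev {K G} x : rename.

Section Topology.
Variables (K : closedFieldType) (G : affAlgGroup K).

Definition zariski_closed (Z : set G) : Prop :=
  exists S : set (coord G), Z = [set x | forall f, S f -> ev x f = 0].

Definition irreducible_closed (Z : set G) : Prop :=
  [/\ zariski_closed Z, Z !=set0 &
      forall Z1 Z2, zariski_closed Z1 -> zariski_closed Z2 ->
        Z `<=` Z1 `|` Z2 -> Z `<=` Z1 \/ Z `<=` Z2].

(* The dimension of the Zariski topological space G. *)
Definition zariski_dim (R : realType) : \bar R :=
  ereal_sup [set k%:R%:E | k in [set k : nat | exists Z : nat -> set G,
    (forall i, (i <= k)%N -> irreducible_closed (Z i)) /\
    (forall i, (i < k)%N -> Z i `<` Z i.+1)]].

End Topology.

Arguments zariski_dim {K} G R.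

Section Sweedler.
Variables (K : closedFieldType) (G : affAlgGroup K).
Local Notation O := (coord G).

(* A finite family (a_1, a_2) with Delta a = \sum a_1 (x) a_2.  It depends on a
   choice, but the value of a bilinear map on it does not (sum2_wd). *)
Definition Delta (a : O) : seq (O * O) := projT1 (cid (coord_mul a)).

Definition Delta2 (a : O) : seq (O * O * O) :=
  [seq (p.1, q.1, q.2) | p <- Delta a, q <- Delta p.2].

Definition counit (a : O) : K := ev (1%g : G) a.

(* rtrans g f is the function x |-> f (x * g), see ev_rtrans. *)
Definition rtrans (g : G) (f : O) : O := \sum_(p <- Delta f) ev g p.2 *: p.1.

(* g acts on O(G) by a (locally) unipotent operator. *)
Definition unipotent_elt (g : G) : Prop :=
  forall f : O, exists n, iter n (fun h => rtrans g h - h) f = 0.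

Definition unipotent : Prop := forall g : G, unipotent_elt g.

Definition conv (f h : O -> O -> K) (a b : O) : K :=
  \sum_(p <- Delta a) \sum_(q <- Delta b) f p.1 q.1 * h p.2 q.2.

(* Linear forms on O(G) (x) O(G) are given as bilinear forms. *)
Record hopf2cocycle := Hopf2Cocycle {
  cocycle :> {biscalar O};
  cocycleV : {biscalar O};
  cocycleVr : forall a b, conv cocycle cocycleV a b = counit a * counit b;
  cocycleVl : forall a b, conv cocycleV cocycle a b = counit a * counit b;
  cocycleE : forall a b c,
    \sum_(p <- Delta a) \sum_(q <- Delta b) cocycle (p.1 * q.1) c * cocycle p.2 q.2
    = \sum_(q <- Delta b) \sum_(r <- Delta c) cocycle a (q.1 * r.1) * cocycle q.2 r.2;
  cocycle1r : forall a, cocycle a 1 = counit a;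
  cocycle1l : forall a, cocycle 1 a = counit a
}.

Definition tmul (J : hopf2cocycle) (a b : O) : O :=
  \sum_(p <- Delta2 a) \sum_(q <- Delta2 b)
    (cocycleV J p.1.1 q.1.1 * J p.2 q.2) *: (p.1.2 * q.1.2).

Lemma evZ x k (a : O) : ev x (k *: a) = k * ev x a :> K.
Proof. exact: (linearZ_LR (ev x)). Qed.

Lemma evD x (a b : O) : ev x (a + b) = ev x a + ev x b :> K.
Proof. exact: raddfD. Qed.

Lemma evB x (a b : O) : ev x (a - b) = ev x a - ev x b :> K.
Proof. exact: raddfB. Qed.

Lemma evM x (a b : O) : ev x (a * b) = ev x a * ev x b :> K.
Proof. exact: rmorphM. Qed.

Lemma ev1 x : ev x (1 : O) = 1 :> K.
Proof. exact: rmorph1. Qed.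

Lemma ev0 x : ev x (0 : O) = 0 :> K.
Proof. exact: raddf0. Qed.

Lemma ev_sum x I (r : seq I) (F : I -> O) :
  ev x (\sum_(i <- r) F i) = \sum_(i <- r) ev x (F i) :> K.
Proof. exact: raddf_sum. Qed.

Lemma DeltaE (a : O) x y :
  ev (x * y)%g a = \sum_(p <- Delta a) ev x p.1 * ev y p.2 :> K.
Proof. by rewrite /Delta; case: cid => s /= ->. Qed.

Lemma ev_rtrans (g x : G) (f : O) : ev x (rtrans g f) = ev (x * g)%g f :> K.
Proof.
rewrite DeltaE ev_sum; apply: eq_bigr => p _.
by rewrite evZ mulrC.
Qed.

Definition lin (f : O -> K) := forall k a b, f (k *: a + b) = k * f a + f b.
Definition bil (f : O -> O -> K) := (forall b, lin (f^~ b)) /\ (forall a, lin (f a)).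
Definition tri (f : O -> O -> O -> K) :=
  [/\ forall b c, lin (fun a => f a b c), forall a c, lin (fun b => f a b c) &
      forall a b, lin (fun c => f a b c)].

Lemma linD f a b : lin f -> f (a + b) = f a + f b.
Proof. by move=> H; rewrite -[a]scale1r H mul1r scale1r. Qed.

Lemma lin0 f : lin f -> f 0 = 0.
Proof. by move=> H; apply: (@addrI _ (f 0)); rewrite -linD // !addr0. Qed.

Lemma linZ f k a : lin f -> f (k *: a) = k * f a.
Proof. by move=> H; rewrite -[k *: a]addr0 H lin0 ?addr0. Qed.

Lemma lin_sum f I (r : seq I) (F : I -> O) :
  lin f -> f (\sum_(i <- r) F i) = \sum_(i <- r) f (F i).
Proof.
move=> H; elim: r => [|i r IH]; first by rewrite !big_nil lin0.
by rewrite !big_cons linD // IH.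
Qed.

Lemma lin_bigsum I (r : seq I) (F : I -> O -> K) :
  (forall i, lin (F i)) -> lin (fun a => \sum_(i <- r) F i a).
Proof.
move=> H k a b; rewrite mulr_sumr -big_split /=.
by apply: eq_bigr => i _; apply: H.
Qed.

Lemma lin_mulr f k : lin f -> lin (fun a => f a * k).
Proof. by move=> H c a b; rewrite H mulrDl mulrA. Qed.

Lemma lin_mull f k : lin f -> lin (fun a => k * f a).
Proof. by move=> H c a b; rewrite H mulrDr mulrCA. Qed.

Lemma lin_ev x : lin (fun a => ev x a).
Proof. by move=> k a b; rewrite evD evZ. Qed.

Lemma lin_evMl x b : lin (fun a => ev x (a * b)).
Proof. by move=> k a c; rewrite mulrDl -scalerAl evD evZ. Qed.

Lemma lin_evMr x b : lin (fun a => ev x (b * a)).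
Proof. by move=> k a c; rewrite mulrDr -scalerAr evD evZ. Qed.

Lemma bil_biscalar (f : {biscalar O}) : bil f.
Proof. by split=> [b k a c|a k b c]; rewrite ?linearPl ?linearPr. Qed.

Lemma interp (s : seq O) : exists t : seq (G * O),
  forall a, a \in s -> a = \sum_(q <- t) ev q.1 a *: q.2.
Proof.
elim: s => [|a s [t IH]]; first by exists [::].
pose r := a - \sum_(q <- t) ev q.1 a *: q.2.
have [r0|/eqP r0] := eqVneq r 0.
  exists t => b; rewrite inE => /orP[/eqP->|/IH //].
  by move/eqP: r0; rewrite subr_eq0 => /eqP.
have [x rx] : exists x, ev x r != 0.
  apply: contrapT => /forallNP H; apply: r0; apply: coord_ext => x.
  by rewrite ev0; apply/eqP/negPn/negP/H.
pose e := (ev x r)^-1 *: r.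
exists ((x, e) :: [seq (q.1, q.2 - ev x q.2 *: e) | q <- t]) => b.
have E c : \sum_(q <- (x, e) :: [seq (q.1, q.2 - ev x q.2 *: e) | q <- t])
             ev q.1 c *: q.2
   = \sum_(q <- t) ev q.1 c *: q.2
     + ev x (c - \sum_(q <- t) ev q.1 c *: q.2) *: e.
  rewrite big_cons big_map /=.
  under eq_bigr do rewrite scalerBr scalerA.
  rewrite sumrB -scaler_suml evB ev_sum scalerBl addrCA.
  congr (_ + (_ - _)); congr (_ *: _); apply: eq_bigr => q _.
  by rewrite evZ.
rewrite E inE => /orP[/eqP->|/IH <-]; last by rewrite subrr ev0 scale0r addr0.
by rewrite -/r /e scalerA mulfV // scale1r addrC subrK.
Qed.

Lemma lin_interp f (s : seq O) (t : seq (G * O)) a : lin f ->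
  (forall a, a \in s -> a = \sum_(q <- t) ev q.1 a *: q.2) -> a \in s ->
  f a = \sum_(q <- t) ev q.1 a * f q.2.
Proof.
move=> H E /E {1}->; rewrite lin_sum //.
by apply: eq_bigr => q _; rewrite linZ.
Qed.

Lemma sum2_wd (s t : seq (O * O)) F : bil F ->
  (forall x y, \sum_(p <- s) ev x p.1 * ev y p.2 =
               \sum_(p <- t) ev x p.1 * ev y p.2) ->
  \sum_(p <- s) F p.1 p.2 = \sum_(p <- t) F p.1 p.2.
Proof.
move=> [F1 F2] H.
have [u1 E1] := interp [seq p.1 | p <- s ++ t].
have [u2 E2] := interp [seq p.2 | p <- s ++ t].
have E (r : seq (O * O)) : {subset r <= s ++ t} -> \sum_(p <- r) F p.1 p.2 =
    \sum_(i <- u1) \sum_(j <- u2) F i.2 j.2 *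
       \sum_(p <- r) ev i.1 p.1 * ev j.1 p.2.
  move=> sr; under [RHS]eq_bigr do under eq_bigr do rewrite mulr_sumr.
  under [RHS]eq_bigr do rewrite exchange_big /=.
  rewrite exchange_big /=; apply: eq_big_seq => p /sr pr.
  rewrite (lin_interp (F1 _) E1) ?map_f //; apply: eq_bigr => i _.
  rewrite (lin_interp (F2 _) E2) ?map_f // mulr_sumr; apply: eq_bigr => j _.
  by rewrite mulrA mulrC.
rewrite !E; first by apply: eq_bigr => i _; apply: eq_bigr => j _; rewrite H.
- by move=> p pt; rewrite mem_cat pt orbT.
- by move=> p ps; rewrite mem_cat ps.
Qed.

Lemma sum3_wd (s t : seq (O * O * O)) F : tri F ->
  (forall x y z, \sum_(p <- s) ev x p.1.1 * ev y p.1.2 * ev z p.2 =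
                 \sum_(p <- t) ev x p.1.1 * ev y p.1.2 * ev z p.2) ->
  \sum_(p <- s) F p.1.1 p.1.2 p.2 = \sum_(p <- t) F p.1.1 p.1.2 p.2.
Proof.
move=> [F1 F2 F3] H.
have [u1 E1] := interp [seq p.1.1 | p <- s ++ t].
have [u2 E2] := interp [seq p.1.2 | p <- s ++ t].
have [u3 E3] := interp [seq p.2 | p <- s ++ t].
have E (r : seq (O * O * O)) : {subset r <= s ++ t} ->
    \sum_(p <- r) F p.1.1 p.1.2 p.2 =
    \sum_(i <- u1) \sum_(j <- u2) \sum_(k <- u3) F i.2 j.2 k.2 *
       \sum_(p <- r) ev i.1 p.1.1 * ev j.1 p.1.2 * ev k.1 p.2.
  move=> sr.
  under [RHS]eq_bigr do under eq_bigr do under eq_bigr do rewrite mulr_sumr.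
  under [RHS]eq_bigr do under eq_bigr do rewrite exchange_big /=.
  under [RHS]eq_bigr do rewrite exchange_big /=.
  rewrite exchange_big /=; apply: eq_big_seq => p /sr pr.
  have p1 := map_f (fun p => p.1.1) pr; have p2 := map_f (fun p => p.1.2) pr.
  have p3 := map_f (fun p => p.2) pr.
  rewrite (lin_interp (F1 _ _) E1) //; apply: eq_bigr => i _.
  rewrite (lin_interp (F2 _ _) E2) // mulr_sumr; apply: eq_bigr => j _.
  rewrite (lin_interp (F3 _ _) E3) // !mulr_sumr; apply: eq_bigr => k _.
  by rewrite mulrA mulrA mulrC.
rewrite !E; first by do 3!apply: eq_bigr => ? _; rewrite H.
- by move=> p pt; rewrite mem_cat pt orbT.
- by move=> p ps; rewrite mem_cat ps.
Qed.

Definition sw (F : O -> O -> K) (a : O) : K := \sum_(p <- Delta a) F p.1 p.2.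

Lemma eq_sw F H a : (forall u v, F u v = H u v) -> sw F a = sw H a.
Proof. by move=> E; apply: eq_bigr => p _. Qed.

Lemma swC F a b : sw (fun u v => sw (F u v) b) a =
                  sw (fun w z => sw (fun u v => F u v w z) a) b.
Proof. exact: exchange_big. Qed.

Lemma sw_mulr F k a : sw F a * k = sw (fun u v => F u v * k) a.
Proof. exact: mulr_suml. Qed.

Lemma sw_mull F k a : k * sw F a = sw (fun u v => k * F u v) a.
Proof. exact: mulr_sumr. Qed.

Lemma lin_swr (F : O -> O -> O -> K) a :
  (forall u v, lin (fun x => F x u v)) -> lin (fun x => sw (F x) a).
Proof. by move=> H; apply: lin_bigsum => p. Qed.

Lemma lin_sw F : bil F -> lin (sw F).
Proof.
move=> BF k a b; have [F1 F2] := BF.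
rewrite /sw mulr_sumr.
have -> : \sum_(p <- Delta a) k * F p.1 p.2 =
          \sum_(p <- [seq (k *: p.1, p.2) | p <- Delta a]) F p.1 p.2.
  by rewrite big_map; apply: eq_bigr => p _; rewrite (linZ _ _ (F1 _)).
rewrite -big_cat; apply: sum2_wd => // x y.
rewrite big_cat big_map /= -!DeltaE evD evZ DeltaE mulr_sumr.
by congr (_ + _); apply: eq_bigr => p _; rewrite evZ mulrA.
Qed.

Lemma sw1 F : bil F -> sw F 1 = F 1 1.
Proof.
move=> BF; rewrite /sw (@sum2_wd _ [:: (1, 1)]) ?big_seq1 // => x y.
by rewrite -DeltaE big_seq1 !ev1 mulr1.
Qed.

Lemma swM F a b : bil F ->
  sw F (a * b) = sw (fun u v => sw (fun w z => F (u * w) (v * z)) b) a.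
Proof.
move=> BF; rewrite /sw.
rewrite (@sum2_wd _ [seq (p.1 * q.1, p.2 * q.2) | p <- Delta a, q <- Delta b]) //.
  by rewrite big_allpairs_dep.
move=> x y; rewrite -DeltaE big_allpairs_dep evM !DeltaE mulr_suml.
apply: eq_bigr => p _; rewrite mulr_sumr; apply: eq_bigr => q _.
by rewrite !evM mulrACA.
Qed.

Lemma sw_coassoc (T : O -> O -> O -> K) a : tri T ->
  sw (fun u v => sw (fun u1 u2 => T u1 u2 v) u) a =
  sw (fun u v => sw (fun v1 v2 => T u v1 v2) v) a.
Proof.
move=> HT; rewrite /sw.
pose s := [seq (q.1, q.2, p.2) | p <- Delta a, q <- Delta p.1].
transitivity (\sum_(r <- s) T r.1.1 r.1.2 r.2); first by rewrite big_allpairs_dep.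
transitivity (\sum_(r <- Delta2 a) T r.1.1 r.1.2 r.2); last first.
  by rewrite big_allpairs_dep.
apply: sum3_wd => // x y z; rewrite !big_allpairs_dep /=.
transitivity (ev (x * y * z)%g a).
  rewrite DeltaE; apply: eq_bigr => p _.
  by rewrite DeltaE mulr_suml.
rewrite -mulgA DeltaE; apply: eq_bigr => p _.
by rewrite DeltaE mulr_sumr; apply: eq_bigr => q _; rewrite mulrA.
Qed.

Lemma sw_counitl f a : lin f -> sw (fun u v => counit u * f v) a = f a.
Proof.
move=> Hf; rewrite /sw; under eq_bigr do rewrite -linZ //.
rewrite -lin_sum //; congr f; apply: coord_ext => x.
rewrite ev_sum -[x in RHS]mul1g DeltaE.
by apply: eq_bigr => p _; rewrite linearZ.
Qed.

Lemma sw_counitr f a : lin f -> sw (fun u v => f u * counit v) a = f a.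
Proof.
move=> Hf; rewrite /sw; under eq_bigr do rewrite mulrC -linZ //.
rewrite -lin_sum //; congr f; apply: coord_ext => x.
rewrite ev_sum -[x in RHS]mulg1 DeltaE.
by apply: eq_bigr => p _; rewrite evZ mulrC.
Qed.

Lemma lin_compl f b : lin f -> lin (fun a => f (a * b)).
Proof. by move=> H k a c; rewrite mulrDl -scalerAl H. Qed.

Lemma lin_compr f b : lin f -> lin (fun a => f (b * a)).
Proof. by move=> H k a c; rewrite mulrDr -scalerAr H. Qed.

Lemma lin_counit : lin counit.
Proof. exact: lin_ev. Qed.

Lemma bil_ev x : bil (fun a b => ev x (a * b)).
Proof. by split=> a; [apply: lin_evMl|apply: lin_evMr]. Qed.

Ltac lin_tac := repeat match goal with
  | |- bil _ => split=> ?
  | |- tri _ => split=> ? ?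
  | |- lin counit => exact: lin_counit
  | |- lin (fun u => counit u) => exact: lin_counit
  | |- lin (fun u => sw (fun v w => _) ?a) => apply: lin_swr => ? ?
  | |- lin (fun u => sw _ u) => apply: lin_sw
  | |- lin (sw _) => apply: lin_sw
  | |- lin (fun u => _ * ?k) => apply: lin_mulr
  | |- lin (fun u => ?k * _) => apply: lin_mull
  | H : bil ?f |- lin (fun u => ?f (@GRing.mul _ u ?b) ?c) =>
      exact (@lin_compl (fun u => f u c) b (H.1 c))
  | H : bil ?f |- lin (fun u => ?f (@GRing.mul _ ?b u) ?c) =>
      exact (@lin_compr (fun u => f u c) b (H.1 c))
  | H : bil ?f |- lin (fun u => ?f ?c (@GRing.mul _ u ?b)) =>
      exact (@lin_compl (fun u => f c u) b (H.2 c))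
  | H : bil ?f |- lin (fun u => ?f ?c (@GRing.mul _ ?b u)) =>
      exact (@lin_compr (fun u => f c u) b (H.2 c))
  | H : bil ?f |- lin (fun u => ?f u _) => exact (H.1 _)
  | H : bil ?f |- lin (?f _) => exact (H.2 _)
  | H : bil ?f |- lin (fun u => ?f _ u) => exact (H.2 _)
  | H : tri ?f |- lin (fun u => ?f u _ _) => case: H => H _ _; exact: H
  | H : tri ?f |- lin (fun u => ?f _ u _) => case: H => _ H _; exact: H
  | H : tri ?f |- lin (?f _ _) => case: H => _ _ H; exact: H
  | H : tri ?f |- lin (fun u => ?f _ _ u) => case: H => _ _ H; exact: H
  end.

Definition conv3 (f h : O -> O -> O -> K) a b c : K :=
  sw (fun a1 a2 => sw (fun b1 b2 => sw (fun c1 c2 => f a1 b1 c1 * h a2 b2 c2) c) b) a.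

Lemma convE f h a b :
  conv f h a b = sw (fun a1 a2 => sw (fun b1 b2 => f a1 b1 * h a2 b2) b) a.
Proof. by []. Qed.

Lemma bil_conv f h : bil f -> bil h -> bil (conv f h).
Proof.
move=> Hf Hh.
change (bil (fun a b => sw (fun a1 a2 => sw (fun b1 b2 => f a1 b1 * h a2 b2) b) a)).
by lin_tac.
Qed.

Lemma tri_conv3 f h : tri f -> tri h -> tri (conv3 f h).
Proof. by move=> Hf Hh; rewrite /conv3; lin_tac. Qed.

Lemma eq_conv3 f f' h h' a b c :
  (forall a b c, f a b c = f' a b c) -> (forall a b c, h a b c = h' a b c) ->
  conv3 f h a b c = conv3 f' h' a b c.
Proof. by move=> E E'; do 3!apply: eq_sw => ? ?; rewrite E E'. Qed.

Lemma conv3A f h l a b c : tri f -> tri h -> tri l ->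
  conv3 (conv3 f h) l a b c = conv3 f (conv3 h l) a b c.
Proof.
move=> Hf Hh Hl; rewrite /conv3.
transitivity (sw (fun u v => sw (fun u1 u2 => sw (fun w z => sw (fun w1 w2 =>
    sw (fun r s => sw (fun r1 r2 => f u1 w1 r1 * h u2 w2 r2 * l v z s) r) c) w) b) u) a).
  apply: eq_sw => u v; rewrite [RHS]swC; apply: eq_sw => w z.
  transitivity (sw (fun u1 u2 => sw (fun r s => sw (fun w1 w2 =>
     sw (fun r1 r2 => f u1 w1 r1 * h u2 w2 r2 * l v z s) r) w) c) u).
    rewrite [RHS]swC; apply: eq_sw => r s.
    rewrite sw_mulr; apply: eq_sw => u1 u2; rewrite sw_mulr; apply: eq_sw => w1 w2.
    by rewrite sw_mulr.
  by apply: eq_sw => u1 u2; exact: swC.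
rewrite (sw_coassoc (T := fun u1 u2 v => sw (fun w z => sw (fun w1 w2 =>
    sw (fun r s => sw (fun r1 r2 => f u1 w1 r1 * h u2 w2 r2 * l v z s) r) c) w) b)); last by lin_tac.
transitivity (sw (fun u v => sw (fun v1 v2 => sw (fun w z => sw (fun z1 z2 =>
    sw (fun r s => sw (fun s1 s2 => f u w r * h v1 z1 s1 * l v2 z2 s2) s) c) z) b) v) a).
  apply: eq_sw => u v; apply: eq_sw => v1 v2.
  rewrite (sw_coassoc (T := fun w1 w2 z =>
    sw (fun r s => sw (fun r1 r2 => f u w1 r1 * h v1 w2 r2 * l v2 z s) r) c)); last by lin_tac.
  apply: eq_sw => w z; apply: eq_sw => z1 z2.
  by rewrite (sw_coassoc (T := fun r1 r2 s => f u w r1 * h v1 z1 r2 * l v2 z2 s)); last by lin_tac.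
apply: eq_sw => u v; rewrite swC; apply: eq_sw => w z.
transitivity (sw (fun v1 v2 => sw (fun r s => sw (fun z1 z2 =>
     sw (fun s1 s2 => f u w r * h v1 z1 s1 * l v2 z2 s2) s) z) c) v).
  by apply: eq_sw => v1 v2; exact: swC.
rewrite swC; apply: eq_sw => r s.
rewrite sw_mull; apply: eq_sw => v1 v2; rewrite sw_mull; apply: eq_sw => z1 z2.
by rewrite sw_mull; apply: eq_sw => s1 s2; rewrite mulrA.
Qed.

Definition eps3 (a b c : O) : K := counit a * counit b * counit c.

Lemma conv3e1 f a b c : tri f -> conv3 eps3 f a b c = f a b c.
Proof.
move=> Hf; rewrite /conv3 /eps3.
transitivity (sw (fun a1 a2 => counit a1 * sw (fun b1 b2 => counit b1 *
    sw (fun c1 c2 => counit c1 * f a2 b2 c2) c) b) a).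
  apply: eq_sw => u v; rewrite sw_mull; apply: eq_sw => w z.
  by rewrite !sw_mull; apply: eq_sw => r s; rewrite !mulrA.
rewrite (sw_counitl (f := fun a2 => sw (fun b1 b2 => counit b1 *
    sw (fun c1 c2 => counit c1 * f a2 b2 c2) c) b)); last by lin_tac.
rewrite (sw_counitl (f := fun b2 => sw (fun c1 c2 => counit c1 * f a b2 c2) c)); last by lin_tac.
by rewrite (sw_counitl (f := fun c2 => f a b c2)); last by lin_tac.
Qed.

Lemma conv31e f a b c : tri f -> conv3 f eps3 a b c = f a b c.
Proof.
move=> Hf; rewrite /conv3 /eps3.
transitivity (sw (fun a1 a2 => sw (fun b1 b2 =>
    sw (fun c1 c2 => f a1 b1 c1 * counit c2) c * counit b2) b * counit a2) a).
  apply: eq_sw => u v; rewrite sw_mulr; apply: eq_sw => w z.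
  rewrite !sw_mulr; apply: eq_sw => r s.
  by rewrite -!mulrA; congr (_ * _); rewrite mulrC -mulrA mulrCA mulrC mulrAC -mulrA.
rewrite (sw_counitr (f := fun a1 => sw (fun b1 b2 =>
    sw (fun c1 c2 => f a1 b1 c1 * counit c2) c * counit b2) b)); last by lin_tac.
rewrite (sw_counitr (f := fun b1 => sw (fun c1 c2 => f a b1 c1 * counit c2) c)); last by lin_tac.
by rewrite (sw_counitr (f := fun c1 => f a b c1)); last by lin_tac.
Qed.

Definition M12 (f : O -> O -> K) a b c : K := f (a * b) c.
Definition M23 (f : O -> O -> K) a b c : K := f a (b * c).
Definition L12 (f : O -> O -> K) a b c : K := f a b * counit c.
Definition L23 (f : O -> O -> K) a b c : K := counit a * f b c.

Lemma tri_M12 f : bil f -> tri (M12 f).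
Proof. by move=> Hf; rewrite /M12; lin_tac. Qed.
Lemma tri_M23 f : bil f -> tri (M23 f).
Proof. by move=> Hf; rewrite /M23; lin_tac. Qed.
Lemma tri_L12 f : bil f -> tri (L12 f).
Proof. by move=> Hf; rewrite /L12; lin_tac. Qed.
Lemma tri_L23 f : bil f -> tri (L23 f).
Proof. by move=> Hf; rewrite /L23; lin_tac. Qed.

Lemma conv3_M12 f h a b c : bil f -> bil h ->
  conv3 (M12 f) (M12 h) a b c = M12 (conv f h) a b c.
Proof.
move=> Hf Hh; rewrite /M12 convE.
by rewrite (swM (F := fun u v => sw (fun w z => f u w * h v z) c)); last by lin_tac.
Qed.

Lemma conv3_M23 f h a b c : bil f -> bil h ->
  conv3 (M23 f) (M23 h) a b c = M23 (conv f h) a b c.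
Proof.
move=> Hf Hh; rewrite /M23 convE; apply: eq_sw => u v.
by rewrite (swM (F := fun w z => f u w * h v z)); last by lin_tac.
Qed.

Lemma conv3_L12 f h a b c : bil f -> bil h ->
  conv3 (L12 f) (L12 h) a b c = L12 (conv f h) a b c.
Proof.
move=> Hf Hh; rewrite /L12 convE sw_mulr; apply: eq_sw => u v.
rewrite sw_mulr; apply: eq_sw => w z.
rewrite -[counit c in RHS](sw_counitl (f := counit)); last by lin_tac.
by rewrite sw_mull; apply: eq_sw => r s; rewrite mulrACA.
Qed.

Lemma conv3_L23 f h a b c : bil f -> bil h ->
  conv3 (L23 f) (L23 h) a b c = L23 (conv f h) a b c.
Proof.
move=> Hf Hh; rewrite /L23 convE.
rewrite -[counit a in RHS](sw_counitl (f := counit)); last by lin_tac.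
rewrite sw_mulr; apply: eq_sw => u v.
rewrite sw_mull; apply: eq_sw => w z; rewrite sw_mull; apply: eq_sw => r s.
by rewrite mulrACA.
Qed.

Lemma counitM a b : counit (a * b) = counit a * counit b.
Proof. exact: evM. Qed.

Variable J : hopf2cocycle.
Let j : O -> O -> K := J.
Let i : O -> O -> K := cocycleV J.

Let bj : bil j. Proof. exact: bil_biscalar. Qed.
Let bi : bil i. Proof. exact: bil_biscalar. Qed.

Lemma lin_tmul (f : O -> K) a b : lin f ->
  f (tmul J a b) = conv i (conv (fun u v => f (u * v)) j) a b.
Proof.
move=> Hf; rewrite /tmul big_allpairs_dep lin_sum //; apply: eq_bigr => p _.
rewrite lin_sum //.
under eq_bigr do rewrite big_allpairs_dep lin_sum //.
under eq_bigr do under eq_bigr do rewrite lin_sum //.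
rewrite exchange_big /=; apply: eq_bigr => q _.
rewrite convE /sw mulr_sumr; apply: eq_bigr => p' _.
rewrite mulr_sumr; apply: eq_bigr => q' _ /=.
by rewrite linZ // mulrAC mulrA.
Qed.

Lemma tmul_M12 f a b c : bil f ->
  f (tmul J a b) c = conv3 (L12 i) (conv3 (M12 f) (L12 j)) a b c.
Proof.
move=> Hf; rewrite (lin_tmul (f := f^~ c)); last exact: (Hf.1 c).
rewrite convE; apply: eq_sw => u v; apply: eq_sw => w z.
rewrite /L12 /conv3 /M12 convE.
transitivity (sw (fun r s => counit r * (i u w * sw (fun v1 v2 => sw (fun z1 z2 =>
    sw (fun s1 s2 => (f (v1 * z1) s1 * j v2 z2) * counit s2) s) z) v)) c).
  rewrite (sw_counitl (f := fun s => i u w * sw (fun v1 v2 => sw (fun z1 z2 =>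
    sw (fun s1 s2 => (f (v1 * z1) s1 * j v2 z2) * counit s2) s) z) v)); last by lin_tac.
  congr (_ * _); apply: eq_sw => v1 v2; apply: eq_sw => z1 z2.
  by rewrite (sw_counitr (f := fun s1 => f (v1 * z1) s1 * j v2 z2)); last by lin_tac.
apply: eq_sw => r s; rewrite mulrA [counit r * _]mulrC; congr (_ * _).
by do 3!apply: eq_sw => ? ?; rewrite mulrA.
Qed.

Lemma tmul_M23 f a b c : bil f ->
  f a (tmul J b c) = conv3 (L23 i) (conv3 (M23 f) (L23 j)) a b c.
Proof.
move=> Hf; rewrite (lin_tmul (f := f a)); last exact: (Hf.2 a).
rewrite /L23 /conv3 /M23.
transitivity (sw (fun u v => counit u * conv i (conv (fun b c => f v (b * c)) j) b c) a).
  rewrite (sw_counitl (f := fun v => conv i (conv (fun b c => f v (b * c)) j) b c)) //.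
  change (lin (fun v => sw (fun b1 b2 => sw (fun c1 c2 => i b1 c1 *
    sw (fun b3 b4 => sw (fun c3 c4 => f v (b3 * c3) * j b4 c4) c2) b2) c) b)).
  by lin_tac.
apply: eq_sw => u v; rewrite convE sw_mull; apply: eq_sw => w z.
rewrite sw_mull; apply: eq_sw => r s; rewrite mulrA; congr (_ * _).
transitivity (sw (fun v1 v2 => conv (fun b c => f v1 (b * c)) j z s * counit v2) v).
  rewrite (sw_counitr (f := fun v1 => conv (fun b c => f v1 (b * c)) j z s)) //.
  change (lin (fun v => sw (fun b3 b4 => sw (fun c3 c4 => f v (b3 * c3) * j b4 c4) s) z)).
  by lin_tac.
apply: eq_sw => v1 v2; rewrite convE sw_mulr; apply: eq_sw => z1 z2.
by rewrite sw_mulr; apply: eq_sw => s1 s2; rewrite -mulrA [j _ _ * _]mulrC.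
Qed.

Let j1l a : j 1 a = counit a. Proof. exact: (cocycle1l J). Qed.
Let j1r a : j a 1 = counit a. Proof. exact: (cocycle1r J). Qed.

Lemma cocycle3E : conv3 (M12 j) (L12 j) = conv3 (M23 j) (L23 j).
Proof.
apply/funext => a; apply/funext => b; apply/funext => c.
transitivity (sw (fun u v => sw (fun w z => j (u * w) c * j v z) b) a).
  apply: eq_sw => u v; apply: eq_sw => w z; rewrite /M12 /L12.
  rewrite -[RHS](sw_counitr (f := fun r => j (u * w) r * j v z)); last first.
    by have Hj := bj; lin_tac.
  by apply: eq_sw => r s; rewrite mulrA.
transitivity (sw (fun w z => sw (fun r s => j a (w * r) * j z s) c) b).
  exact: (cocycleE J).
rewrite /conv3 /M23 /L23.
transitivity (sw (fun u v => sw (fun w z =>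
    sw (fun r s => j u (w * r) * j z s) c) b * counit v) a).
  rewrite (sw_counitr (f := fun u => sw (fun w z =>
    sw (fun r s => j u (w * r) * j z s) c) b)) //.
  by have Hj := bj; lin_tac.
apply: eq_sw => u v; rewrite sw_mulr; apply: eq_sw => w z.
by rewrite sw_mulr; apply: eq_sw => r s; rewrite -mulrA; congr (_ * _); rewrite mulrC.
Qed.

Lemma eq_tri (f h : O -> O -> O -> K) : (forall a b c, f a b c = h a b c) -> f = h.
Proof. by move=> E; do 3!apply/funext => ?; exact: E. Qed.

Lemma conv_ji : conv j i = (fun a b => counit a * counit b).
Proof. by do 2!apply/funext => ?; exact: cocycleVr. Qed.

Lemma conv_ij : conv i j = (fun a b => counit a * counit b).
Proof. by do 2!apply/funext => ?; exact: cocycleVl. Qed.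

Lemma tmulA : associative (tmul J).
Proof.
move=> a b c; apply: coord_ext => x.
pose X u v : K := ev x (u * v).
have bX : bil X := bil_ev x.
have bXj : bil (conv X j) by exact: bil_conv.
have bF : bil (conv i (conv X j)) by exact: bil_conv.
have [tMi tMj tLi tLj] := And4 (tri_M12 bi) (tri_M12 bj) (tri_L12 bi) (tri_L12 bj).
have [tNi tNj tRi tRj] := And4 (tri_M23 bi) (tri_M23 bj) (tri_L23 bi) (tri_L23 bj).
have [tMX tNX] := conj (tri_M12 bX) (tri_M23 bX).
have t3 f h : tri f -> tri h -> tri (conv3 f h) by exact: tri_conv3.
have A f h l : tri f -> tri h -> tri l ->
    conv3 (conv3 f h) l = conv3 f (conv3 h l).
  by move=> *; apply: eq_tri => *; exact: conv3A.
have e1 f : tri f -> conv3 eps3 f = f.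
  by move=> *; apply: eq_tri => *; exact: conv3e1.
have e2 f : tri f -> conv3 f eps3 = f.
  by move=> *; apply: eq_tri => *; exact: conv31e.
have EM f h : bil f -> bil h -> M12 (conv f h) = conv3 (M12 f) (M12 h).
  by move=> *; apply: eq_tri => *; rewrite conv3_M12.
have EN f h : bil f -> bil h -> M23 (conv f h) = conv3 (M23 f) (M23 h).
  by move=> *; apply: eq_tri => *; rewrite conv3_M23.
have MiMj : conv3 (M12 i) (M12 j) = eps3.
  by rewrite -EM // conv_ij; apply: eq_tri => ? ? ?; rewrite /M12 counitM.
have NjNi : conv3 (M23 j) (M23 i) = eps3.
  by rewrite -EN // conv_ji; apply: eq_tri => ? ? ?; rewrite /M23 counitM mulrA.
have LiLj : conv3 (L12 i) (L12 j) = eps3.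
  by apply: eq_tri => ? ? ?; rewrite conv3_L12 // conv_ij.
have RjRi : conv3 (L23 j) (L23 i) = eps3.
  by apply: eq_tri => ? ? ?; rewrite conv3_L23 // conv_ji /L23 /eps3 mulrA.
pose P := conv3 (M12 j) (L12 j).
pose Q := conv3 (L12 i) (M12 i).
pose Q' := conv3 (L23 i) (M23 i).
have [tP tQ tQ'] : [/\ tri P, tri Q & tri Q'] by split; exact: t3.
have QP : conv3 Q P = eps3.
  rewrite /Q A // -[conv3 (M12 i) P]A // MiMj e1 //.
have PQ : conv3 P Q' = eps3.
  by rewrite /P cocycle3E A // -[conv3 (L23 j) Q']A // RjRi e1.
have QQ : Q = Q' by rewrite -[Q]e2 // -PQ -A // QP e1.
have MXE : M12 X = M23 X by apply: eq_tri => ? ? ?; rewrite /M12 /M23 /X mulrA.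
have E u v : ev x (tmul J u v) = conv i (conv X j) u v.
  by rewrite (@lin_tmul (fun u => ev x u)) //; exact: lin_ev.
rewrite !E tmul_M23 // tmul_M12 // EM // EM // EN // EN //.
congr (_ a b c).
have tXP : tri (conv3 (M12 X) P) by exact: t3.
have {}tP' : tri (conv3 (M23 j) (L23 j)) by exact: t3.
transitivity (conv3 Q' (conv3 (M12 X) P)).
  rewrite /P cocycle3E MXE /Q' [RHS]A //; last exact: t3.
  by rewrite [conv3 (conv3 (M23 i) _) _]A ?[conv3 (conv3 (M23 X) _) _]A //; exact: t3.
rewrite -QQ /Q A //.
by rewrite [conv3 (conv3 (M12 i) _) _]A ?[conv3 (conv3 (M12 X) _) _]A //; exact: t3.
Qed.

Lemma tmulPl k a b c : tmul J (k *: a + b) c = k *: tmul J a c + tmul J b c.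
Proof.
apply: coord_ext => x; rewrite evD evZ.
have E u v : ev x (tmul J u v) = conv i (conv (fun u v => ev x (u * v)) j) u v.
  by rewrite (@lin_tmul (fun u => ev x u)) //; exact: lin_ev.
by rewrite !E (bil_conv bi (bil_conv (bil_ev x) bj)).1.
Qed.

Lemma tmulPr k a b c : tmul J c (k *: a + b) = k *: tmul J c a + tmul J c b.
Proof.
apply: coord_ext => x; rewrite evD evZ.
have E u v : ev x (tmul J u v) = conv i (conv (fun u v => ev x (u * v)) j) u v.
  by rewrite (@lin_tmul (fun u => ev x u)) //; exact: lin_ev.
by rewrite !E (bil_conv bi (bil_conv (bil_ev x) bj)).2.
Qed.

Lemma tmulZl k a b : tmul J (k *: a) b = k *: tmul J a b.
Proof.
have t0 : tmul J 0 b = 0.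
  by apply: (@addrI _ (tmul J 0 b)); have := tmulPl 1 0 0 b; rewrite !scale1r !addr0 => <-.
by rewrite -[k *: a]addr0 tmulPl t0 addr0.
Qed.

Lemma tmulZr k a b : tmul J a (k *: b) = k *: tmul J a b.
Proof.
have t0 : tmul J a 0 = 0.
  by apply: (@addrI _ (tmul J a 0)); have := tmulPr 1 0 0 a; rewrite !scale1r !addr0 => <-.
by rewrite -[k *: b]addr0 tmulPr t0 addr0.
Qed.

Lemma counit1 : counit 1 = 1.
Proof. exact: ev1. Qed.

Lemma cocycleV1l a : i 1 a = counit a.
Proof.
have := cocycleVr J 1 a; rewrite convE -/j -/i.
have [Hi Hj] := conj bi bj.
rewrite (sw1 (F := fun u v => sw (fun w z => j u w * i v z) a)); last by lin_tac.
under eq_sw do rewrite j1l.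
rewrite (sw_counitl (f := i 1)); last by lin_tac.
by rewrite counit1 mul1r.
Qed.

Lemma cocycleV1r a : i a 1 = counit a.
Proof.
have := cocycleVr J a 1; rewrite convE -/j -/i.
have [Hi Hj] := conj bi bj.
have -> : sw (fun u v => sw (fun w z => j u w * i v z) 1) a
        = sw (fun u v => counit u * i v 1) a.
  apply: eq_sw => u v.
  by rewrite (sw1 (F := fun w z => j u w * i v z)) ?j1r //; lin_tac.
rewrite (sw_counitl (f := fun a => i a 1)); last by lin_tac.
by rewrite counit1 mulr1.
Qed.

Lemma tmul1l : left_id 1 (tmul J).
Proof.
move=> a; apply: coord_ext => x.
rewrite (@lin_tmul (fun u => ev x u)); last exact: lin_ev.
have [Hi Hj Hx] := And3 bi bj (bil_ev x).
have Hc := bil_conv Hx Hj.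
rewrite convE (sw1 (F := fun u v => sw (fun w z => i u w *
  conv (fun u v => ev x (u * v)) j v z) a)); last by lin_tac.
under eq_sw do rewrite cocycleV1l.
rewrite (sw_counitl (f := fun z => conv (fun u v => ev x (u * v)) j 1 z)); last by lin_tac.
rewrite convE (sw1 (F := fun u v => sw (fun w z => ev x (u * w) * j v z) a)).
  under eq_sw do rewrite mul1r j1l.
  by rewrite (sw_counitr (f := fun u => ev x u)) //; exact: lin_ev.
by split=> ?; lin_tac; exact: lin_evMl.
Qed.

Lemma tmul1r : right_id 1 (tmul J).
Proof.
move=> a; apply: coord_ext => x.
rewrite (@lin_tmul (fun u => ev x u)); last exact: lin_ev.
have [Hi Hj Hx] := And3 bi bj (bil_ev x).
have Hc := bil_conv Hx Hj.
rewrite convE.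
transitivity (sw (fun u v =>
    counit u * conv (fun u v => ev x (u * v)) j v 1) a : K).
  apply: eq_sw => u v.
  rewrite (sw1 (F := fun w z => i u w * conv (fun u v => ev x (u * v)) j v z)).
    by rewrite cocycleV1r.
  by lin_tac.
rewrite (sw_counitl (f := fun z => conv (fun u v => ev x (u * v)) j z 1)); last by lin_tac.
rewrite convE.
transitivity (sw (fun u v => ev x u * counit v) a : K).
  apply: eq_sw => u v.
  rewrite (sw1 (F := fun w z => ev x (u * w) * j v z)) ?mulr1 ?j1r //.
  by split=> ?; lin_tac; exact: lin_evMr.
by rewrite (sw_counitr (f := fun u => ev x u)) //; exact: lin_ev.
Qed.

End Sweedler.

Definition twist_type (K : closedFieldType) (G : affAlgGroup K) (J : hopf2cocycle G) : Type :=
  coord G.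

Section Twist.
Variables (K : closedFieldType) (G : affAlgGroup K) (J : hopf2cocycle G).

HB.instance Definition _ := GRing.Lmodule.copy (twist_type J) (coord G).

Let mul : twist_type J -> twist_type J -> twist_type J := tmul J.
Let one : twist_type J := (1 : coord G).

Let mulDl : left_distributive mul +%R.
Proof. by move=> a b c; have := tmulPl J 1 a b c; rewrite !scale1r. Qed.

Let mulDr : right_distributive mul +%R.
Proof. by move=> a b c; have := tmulPr J 1 b c a; rewrite !scale1r. Qed.

Let one_neq0 : one != 0.
Proof. exact: (oner_neq0 (coord G)). Qed.

HB.instance Definition _ := GRing.Zmodule_isNzRing.Build (twist_type J)
  (@tmulA K G J : associative mul) (@tmul1l K G J : left_id one mul)
  (@tmul1r K G J : right_id one mul) mulDl mulDr one_neq0.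

Let scaleAl (k : K) (a b : twist_type J) : k *: mul a b = mul (k *: a) b.
Proof. exact: (esym (tmulZl J k a b)). Qed.

Let scaleAr (k : K) (a b : twist_type J) : k *: mul a b = mul a (k *: b).
Proof. exact: (esym (tmulZr J k a b)). Qed.

HB.instance Definition _ := GRing.Lmodule_isLalgebra.Build K (twist_type J) scaleAl.
HB.instance Definition _ := GRing.Lalgebra_isAlgebra.Build K (twist_type J) scaleAr.

End Twist.

(* The algebra {}_J O(G)_J: the vector space O(G) with the product tmul J and
   the unit of O(G).  Its coalgebra structure is that of O(G). *)
Definition twist (K : closedFieldType) (G : affAlgGroup K) (J : hopf2cocycle G) :
  algType K := twist_type J.

Lemma twistM (K : closedFieldType) (G : affAlgGroup K) (J : hopf2cocycle G)
  (a b : twist J) : a * b = tmul J a b.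
Proof. by []. Qed.

Lemma twist1 (K : closedFieldType) (G : affAlgGroup K) (J : hopf2cocycle G) :
  1 = (1 : coord G) :> twist J.
Proof. by []. Qed.

(* Main.v *)
Require Import Defs.
From HB Require Import structures.
From mathcomp Require Import all_boot all_order all_algebra.
From mathcomp Require Import all_classical all_reals all_analysis.
From mathcomp Require Import complex ring zify.

(* O(G) is a tower of polynomial extensions H[x], where H is a subalgebra stable
   under left and right translation and every translate of x differs from x by
   an element of H: by Kolchin's theorem there is such an x outside H as long as
   H is not all of O(G), and unipotence together with characteristic 0 makes x
   transcendental over H.  The twisted product of a and b is a linear
   combination of products of translates of a and b, with coefficients that do
   not depend on a and b.  Hence the twisted product of polynomials in x has as
   leading coefficient the twisted product of the leading coefficients, and at
   each stage of the tower the absence of zero divisors, Hilbert's basis theorem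
   and generation by the variables go through as for ordinary polynomials.
   Giving the variables large enough weights, one gets a filtration that is
   stable under translation, thus compatible with both products, and whose
   dimensions grow like n ^ d for a tower of height d; so the
   Gelfand-Kirillov dimension is d.  The points of G are the d-tuples of values of
   the variables, which gives a chain of irreducible closed sets of length d.
   A chain of length k provides k elements whose monomials are linearly
   independent, so k <= d by the growth of the filtration. *)

Set Implicit Arguments.
Unset Strict Implicit.
Unset Printing Implicit Defensive.

Import Order.TTheory GRing.Theory Num.Theory.

Local Open Scope classical_set_scope.
Local Open Scope ring_scope.

(** * Linear algebra *)

Definition subspace (K : fieldType) (V : lmodType K) (W : set V) : Prop :=
  W 0 /\ forall k a b, W a -> W b -> W (k *: a + b).

Section Subspaces.
Variables (K : fieldType) (V : lmodType K).
Implicit Types (W : set V) (s b : seq V) (v : V).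

Lemma subspaceZ W k v : subspace W -> W v -> W (k *: v).
Proof. by move=> [W0 WD] Wv; rewrite -[_ *: _]addr0; apply: WD. Qed.

Lemma subspaceD W u v : subspace W -> W u -> W v -> W (u + v).
Proof. by move=> [_ WD] Wu Wv; rewrite -[u]scale1r; apply: WD. Qed.

Lemma subspaceB W u v : subspace W -> W u -> W v -> W (u - v).
Proof. by move=> sW Wu Wv; apply: subspaceD => //; rewrite -scaleN1r; apply: subspaceZ. Qed.

Lemma subspace_sum W (I : Type) (r : seq I) (P : pred I) (F : I -> V) :
  subspace W -> (forall i, P i -> W (F i)) -> W (\sum_(i <- r | P i) F i).
Proof.
move=> sW WF; elim/big_rec: _ => [|i v Pi Wv]; first exact: sW.1.
by apply: subspaceD => //; apply: WF.
Qed.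

Lemma subspace_sum_seq W (I : eqType) (r : seq I) (F : I -> V) :
  subspace W -> (forall i, i \in r -> W (F i)) -> W (\sum_(i <- r) F i).
Proof. by move=> sW WF; rewrite big_seq; apply: subspace_sum. Qed.

Lemma in_span_subspace s : subspace (in_span s).
Proof.
split=> [|k _ _ [c ->] [d ->]].
  by exists (fun=> 0); rewrite big1 // => i _; rewrite scale0r.
exists (fun i => k * c i + d i); rewrite scaler_sumr -big_split /=.
by apply: eq_bigr => i _; rewrite scalerDl scalerA.
Qed.

Lemma in_span_mem s v : v \in s -> in_span s v.
Proof.
move=> vs; have iv : (index v s < size s)%N by rewrite index_mem.
exists (fun i => (i == Ordinal iv)%:R); rewrite (bigD1 (Ordinal iv)) //= eqxx scale1r.
by rewrite nth_index // big1 ?addr0 // => i /negPf->; rewrite scale0r.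
Qed.

Lemma in_span_sub W s v :
  subspace W -> (forall u, u \in s -> W u) -> in_span s v -> W v.
Proof.
move=> sW Ws [c ->]; apply: subspace_sum => // i _.
by apply: subspaceZ => //; apply/Ws/mem_nth.
Qed.

Lemma in_span_trans s b v :
  (forall u, u \in s -> in_span b u) -> in_span s v -> in_span b v.
Proof. by apply: in_span_sub; apply: in_span_subspace. Qed.

Lemma in_span_codomP (I : finType) (b : I -> V) v :
  in_span (codom b) v <-> exists c : I -> K, v = \sum_i c i *: b i.
Proof.
split=> [|[c ->]]; last first.
  apply: (subspace_sum _ (in_span_subspace _)) => i _.
  by apply: (subspaceZ _ (in_span_subspace _)); apply/in_span_mem/codom_f.
apply: (@in_span_sub (fun v => exists c : I -> K, v = \sum_i c i *: b i)).
  split=> [|k _ _ [c ->] [d ->]].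
    by exists (fun=> 0); rewrite big1 // => i _; rewrite scale0r.
  exists (fun i => k * c i + d i); rewrite scaler_sumr -big_split /=.
  by apply: eq_bigr => i _; rewrite scalerDl scalerA.
move=> _ /codomP[i ->]; exists (fun j => (j == i)%:R); rewrite (bigD1 i) //= eqxx scale1r.
by rewrite big1 ?addr0 // => j /negPf->; rewrite scale0r.
Qed.

Definition lin_free (I : finType) (v : I -> V) : Prop :=
  forall c : I -> K, \sum_i c i *: v i = 0 -> forall i, c i = 0.

(** If the bound failed, the matrix of coefficients of the [v i] would have more rows than columns,
    and a nonzero row in its kernel would be a linear relation. *)
Lemma lin_free_card (I : finType) (v : I -> V) b :
  lin_free v -> (forall i, in_span b (v i)) -> (#|I| <= size b)%N.
Proof.
move=> fv vb; rewrite leqNgt; apply/negP => ltb.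
pose c i := projT1 (cid (vb i)).
have vE i : v i = \sum_j c i j *: b`_j by rewrite /c; case: cid.
pose M := \matrix_(k < #|I|, j < size b) c (enum_val k) j.
have : (kermx M != 0).
  by rewrite kermx_eq0 -row_leq_rank -ltnNge (leq_ltn_trans (rank_leq_col M)).
case/rowV0Pn => u /sub_kermxP uM /negP; apply; apply/eqP/rowP => k; rewrite mxE.
have := fv (fun i => u 0 (enum_rank i)).
move=> /(_ _ (enum_val k)); rewrite enum_valK; apply.
transitivity (\sum_j (u *m M) 0 j *: b`_j).
  under [RHS]eq_bigr do rewrite mxE scaler_suml.
  rewrite exchange_big /= (reindex _ (onW_bij _ (enum_val_bij I))) /=.
  apply: eq_bigr => i _; rewrite enum_valK vE scaler_sumr.
  by apply: eq_bigr => j _; rewrite scalerA mxE.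
by rewrite uM big1 // => j _; rewrite mxE scale0r.
Qed.

Definition free_on (I : finType) (v : I -> V) (A : {set I}) : Prop :=
  forall c : I -> K, \sum_(i in A) c i *: v i = 0 -> forall i, i \in A -> c i = 0.

Lemma free_on_enum (I : finType) (v : I -> V) (A : {set I}) :
  free_on v A -> lin_free (fun k : 'I_#|A| => v (enum_val k)).
Proof.
have [->|[i0 Ai0]] := set_0Vmem A; first by move=> _ c _ [k lk]; exfalso; rewrite cards0 in lk.
move=> fA c; pose d i := c (enum_rank_in Ai0 i).
have E k : c k = d (enum_val k) by rewrite /d enum_valK_in.
under eq_bigr do rewrite E.
rewrite -(big_enum_val (fun i => d i *: v i)) => /fA H k.
by rewrite E H // enum_valP.
Qed.

Lemma free_on_setU1 (I : finType) (v : I -> V) (A : {set I}) j :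
  free_on v A -> ~ in_span [seq v i | i <- enum A] (v j) -> free_on v (j |: A).
Proof.
move=> fA nj c; have [jA|jA] := boolP (j \in A).
  by case: nj; apply: in_span_mem; rewrite map_f // mem_enum.
rewrite big_setU1 //= => E.
have cj : c j = 0.
  apply/eqP/negPn/negP => cj; apply: nj.
  have -> : v j = \sum_(i in A) (- (c j)^-1 * c i) *: v i.
    under eq_bigr do rewrite -scalerA.
    rewrite -scaler_sumr; move/eqP: E; rewrite addrC addr_eq0 => /eqP->.
    by rewrite scalerN scalerA mulNr mulVf // scaleNr opprK scale1r.
  apply: subspace_sum => [|i iA]; first exact: in_span_subspace.
  apply: subspaceZ; first exact: in_span_subspace.
  by apply: in_span_mem; rewrite map_f // mem_enum.
move=> i /setU1P[-> //|]; apply: fA; by rewrite cj scale0r add0r in E.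
Qed.

(** A free subfamily of maximal size spans, since a member of [s] outside its span could be added to
    it by [free_on_setU1]. *)
Lemma span_dim_basis s : exists A : {set 'I_(size s)},
  [/\ free_on (fun i : 'I_(size s) => s`_i) A, span_dim s = #|A| &
      forall v, in_span s v -> in_span [seq s`_(i : 'I__) | i <- enum A] v].
Proof.
pose P (A : {set 'I_(size s)}) := `[< free_on (fun i : 'I_(size s) => s`_i) A >].
have P0 : P finset.set0 by apply/asboolP => c _ i; rewrite inE.
have [A /asboolP fA EA] : {A | P A & span_dim s = #|A|}.
  rewrite /span_dim; apply: eq_bigmax_cond; apply/card_gt0P; exists finset.set0; exact: P0.
exists A; split=> // v; apply: in_span_trans => _ /(nthP 0)[j js <-].
pose k := Ordinal js; apply: contrapT => nk.
have /asboolP fkA := free_on_setU1 (j := k) fA nk.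
have : (#|k |: A| <= span_dim s)%N.
  exact: (@leq_bigmax_cond _ P (fun A : {set _} => #|A|)).
rewrite EA cardsU1; case: (boolP (k \in A)) => [kA|_]; last by rewrite ltnn.
by case: nk; apply: in_span_mem; apply/mapP; exists k; rewrite ?mem_enum.
Qed.

Lemma span_dim_le s b : (forall v, v \in s -> in_span b v) -> (span_dim s <= size b)%N.
Proof.
move=> sb; have [A [/free_on_enum fA -> _]] := span_dim_basis s.
by rewrite -[#|A|]card_ord; apply: lin_free_card fA _ => i; apply/sb/mem_nth.
Qed.

Lemma span_dim_ge (I : finType) (v : I -> V) s :
  lin_free v -> (forall i, in_span s (v i)) -> (#|I| <= span_dim s)%N.
Proof.
move=> fv vs; have [A [_ -> sA]] := span_dim_basis s.
have := lin_free_card fv (fun i => sA _ (vs i)).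
by rewrite size_map -cardE.
Qed.

End Subspaces.

(** * Kolchin's theorem *)

Section NilpotentTrace.
Variables (K : closedFieldType) (n : nat).
Implicit Types a e : 'M[K]_n.+1.

(** Every eigenvalue is 0, so over a closed field the characteristic polynomial is a power of ['X],
    and the trace is its second coefficient up to sign. *)
Lemma mxtrace_nilpotent a k : a ^+ k = 0 -> \tr a = 0.
Proof.
move=> ak0; apply/eqP; rewrite -oppr_eq0 -char_poly_trace //.
have [r pE] := closed_field_poly_normal (char_poly a).
rewrite (eqP (char_poly_monic a)) scale1r in pE.
have r0 z : z \in r -> z = 0.
  move=> zr; have : eigenvalue a z.
    by rewrite eigenvalue_root_char pE root_prod_XsubC.
  case/eigenvalueP => v vz v0.
  have vk j : v *m a ^+ j = z ^+ j *: v.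
    elim: j => [|j IH]; first by rewrite !expr0 mulmx1 scale1r.
    by rewrite exprSr mulmxA IH -scalemxAl vz scalerA -exprSr.
  have /esym/eqP := vk k; rewrite ak0 mulmx0 scaler_eq0 (negPf v0) orbF.
  by rewrite expf_eq0 => /andP[_ /eqP].
have {}pE : char_poly a = 'X^(size r).
  rewrite pE (eq_big_seq (fun=> 'X)); last by move=> z /r0->; rewrite subr0.
  by rewrite big_const_seq count_predT GRing.iter_mulr_1.
have := size_char_poly a; rewrite pE size_polyXn => -[->].
by rewrite coefXn /= ltn_eqF.
Qed.

(** In the full-rank factorization [col_base e *m row_base e], idempotence forces the product in the
    other order to be the identity of size [\rank e]. *)
Lemma mxtrace_idempotent e : e * e = e -> \tr e = (\rank e)%:R.
Proof.
move=> ee; have E := mulmx_base e.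
have : row_base e *m col_base e = 1%:M.
  apply: (row_free_inj (row_base_free e)); apply: (row_full_inj (col_base_full e)).
  by rewrite mul1mx -mulmxA E mulmxA E; exact: ee.
by move=> H; rewrite -{1}E mxtrace_mulC H mxtrace1.
Qed.

Hypothesis pchar0 : [pchar K] =i pred0.

(** Write the characteristic polynomial as [q * 'X^m] with [q] prime to ['X]. A Bezout relation
    yields the idempotent [e] that projects onto the part where [a] is invertible. As a polynomial
    in [a] without constant term, [e] has trace 0, hence rank 0 in characteristic 0, and
    Cayley-Hamilton then gives [a ^+ m = 0]. *)
Lemma nilpotent_mxtrace a : (forall k, \tr (a ^+ k.+1) = 0) -> exists m, a ^+ m = 0.
Proof.
move=> tr0.
have tr0p p : \tr (horner_mx a (p * 'X)) = 0.
  rewrite -[p]coefK poly_def mulr_suml rmorph_sum raddf_sum /= big1 // => i _.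
  rewrite -scalerAl -exprSr linearZ /= rmorphXn /= horner_mx_X.
  by rewrite mxtraceZ tr0 mulr0.
have [m [q q0 pE]] := multiplicity_XsubC (char_poly a) 0.
rewrite subr0 in pE; rewrite monic_neq0 ?char_poly_monic //= in q0.
(* The exponent [m.+1] gives [e] a factor ['X] even when [m] is 0, as [tr0p] requires. *)
have /Bezout_eq1_coprimepP[[s r] /= sr] : coprimep ('X ^+ m.+1) q.
  by rewrite coprimep_expl // coprimep_sym -['X]subr0 coprimep_XsubC.
pose e := horner_mx a (s * 'X^(m.+1)).
have eE : 1 - e = horner_mx a (r * q).
  by rewrite /e -(rmorph1 (horner_mx a)) -sr rmorphD addrAC subrr add0r.
have ee : e * e = e.
  apply/eqP; rewrite eq_sym -subr_eq0 -[X in X - _]mulr1 -mulrBr eE -rmorphM.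
  have -> : s * 'X^(m.+1) * (r * q) = s * 'X * r * (q * 'X^m) by rewrite exprS; ring.
  rewrite -pE.
  by rewrite !rmorphM /= Cayley_Hamilton mulr0.
have e0 : e = 0.
  apply/eqP; rewrite -mxrank_eq0; move/eqP: (mxtrace_idempotent ee).
  by rewrite /e exprSr mulrA tr0p eq_sym ((pcharf0P K).1 pchar0).
exists m; rewrite -[a ^+ m]mul1r -[1 in X in X * _]subr0 -e0 eE.
rewrite -[in a ^+ m](horner_mx_X a) -rmorphXn -rmorphM /= -mulrA -pE.
by rewrite rmorphM /= Cayley_Hamilton mulr0.
Qed.

End NilpotentTrace.

(** [U] has maximal rank among the matrices whose row space lies in [P]; a vector of [P] outside
    this row space could be adjoined to it. *)
Lemma row_subspaceP (K : fieldType) n (P : set 'rV[K]_n) :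
  subspace P -> exists U : 'M[K]_n, forall v : 'rV_n, (v <= U)%MS <-> P v.
Proof.
move=> sP; pose Q r := `[< exists2 U : 'M[K]_n, \rank U = r & forall v : 'rV_n, (v <= U)%MS -> P v >].
have Q0 : exists r, Q r.
  exists 0; apply/asboolP; exists 0; first exact: mxrank0.
  by move=> v; rewrite submx0 => /eqP->; exact: sP.1.
have Qn r : Q r -> (r <= n)%N by move=> /asboolP[U <- _]; exact: rank_leq_row.
have [_ /asboolP[U <- UP] Umax] := ex_maxnP Q0 Qn.
exists U => v; split; first exact: UP.
move=> Pv; apply: contrapT => /negP vU.
have : Q (\rank (U + v)%MS).
  apply/asboolP; exists (U + v)%MS => // w /sub_addsmxP[[a b] /= ->].
  rewrite addrC [b]mx11_scalar mul_scalar_mx; apply: sP.2 => //.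
  by apply/UP/submxMl.
move/Umax; rewrite leqNgt => /negP; apply; rewrite ltn_neqAle mxrankS ?addsmxSl // andbT.
apply: contra vU => /eqP E; apply: submx_trans (addsmxSr U v) _.
by rewrite -(geq_leqif (mxrank_leqif_sup (addsmxSl U v))) E.
Qed.

Section KolchinMatrix.
Variables (K : closedFieldType) (n : nat) (S : set 'M[K]_n.+1).
Hypothesis pchar0 : [pchar K] =i pred0.
Hypotheses (S1 : S 1) (SM : forall A B, S A -> S B -> S (A * B)).
Hypothesis S_unipotent : forall A, S A -> exists k, (A - 1) ^+ k = 0.

(** The linear span of [S] as an intersection of subspaces, so that a linear property is proved on
    it by instantiating [W]. *)
Let spanS (a : 'M[K]_n.+1) := forall W, subspace W -> S `<=` W -> W a.

Let sub_spanS A : S A -> spanS A.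
Proof. by move=> SA W _; apply. Qed.

Let subspace_spanS : subspace spanS.
Proof.
split=> [W sW _|k a b Ha Hb W sW SW]; first exact: sW.1.
by apply: sW.2; [exact: Ha|exact: Hb].
Qed.

Let spanSM a b : spanS a -> spanS b -> spanS (a * b).
Proof.
have spanSMr c B : spanS c -> S B -> spanS (c * B).
  move=> Hc SB W sW SW; apply: (Hc (fun x => W (x * B))) => [|A SA].
    split=> [|k x y Wx Wy]; first by rewrite mul0r; exact: sW.1.
    by rewrite mulrDl -scalerAl; exact: sW.2.
  by apply/SW/SM.
move=> Ha Hb; apply: (Hb (fun y => spanS (a * y))) => [|B SB]; last exact: spanSMr.
split=> [|k x y Wx Wy]; first by rewrite mulr0; exact: subspace_spanS.1.
by rewrite mulrDr -scalerAr; exact: subspace_spanS.2.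
Qed.

(** The radical of the trace form on the algebra spanned by [S]. It is stable under right
    multiplication by [S], its elements are nilpotent and, by unipotence, it contains every
    [A - 1]. *)
Let I (a : 'M[K]_n.+1) := spanS a /\ forall B, S B -> \tr (a * B) = 0.

Let subspace_I : subspace I.
Proof.
split=> [|k a b [Sa ta] [Sb tb]].
  by split=> [|B _]; [exact: subspace_spanS.1|rewrite mul0r linear0].
split=> [|B SB]; first exact: subspace_spanS.2.
by rewrite mulrDl -scalerAl linearD linearZ /= ta // tb // mulr0 addr0.
Qed.

Let I_mulr a B : I a -> S B -> I (a * B).
Proof.
move=> [Sa ta] SB; split=> [|C SC]; first by apply: spanSM => //; apply: sub_spanS.
by rewrite -mulrA ta //; apply: SM.
Qed.

Let I_nilpotent a : I a -> exists m, a ^+ m = 0.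
Proof.
move=> [Sa ta]; apply: nilpotent_mxtrace => // k.
have tS b : spanS b -> \tr (a * b) = 0.
  move=> Sb; apply: (Sb (fun b => \tr (a * b) = 0)); last exact: ta.
  split=> [|c x y tx ty]; first by rewrite mulr0 linear0.
  by rewrite mulrDr -scalerAr linearD linearZ /= tx ty mulr0 addr0.
rewrite exprS; apply: tS; elim: k => [|k IH]; first exact: sub_spanS.
by rewrite exprS; apply: spanSM.
Qed.

(** Unipotent matrices all have the trace of the identity, so [A * B] and [B] have equal traces. *)
Let I_sub1 A : S A -> I (A - 1).
Proof.
move=> SA; split=> [|B SB].
  by apply: (subspaceB subspace_spanS); apply: sub_spanS.
have tr1 C : S C -> \tr C = \tr (1 : 'M[K]_n.+1).
  move=> /S_unipotent[k /mxtrace_nilpotent]; rewrite linearB => /eqP.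
  by rewrite subr_eq0 => /eqP.
by rewrite mulrBl mul1r linearB /= tr1 ?(tr1 B) ?subrr //; apply: SM.
Qed.

(** Choose [W] of minimal rank among the stable row spaces that strictly contain [U], and [w] in [W]
    outside [U]. If some [w *m (A - 1)] were outside [U], then [U + w I] would be stable and
    strictly larger than [U], hence equal to [W] by minimality. So [w] would be congruent to
    [w *m b] modulo [U] for some [b] in [I], thus to all [w *m b ^+ k], and to 0 because [b] is
    nilpotent. *)
Lemma kolchin_mx (U : 'M[K]_n.+1) :
  (forall A, S A -> (U *m A <= U)%MS) -> ~~ (1%:M <= U)%MS ->
  exists2 v : 'rV_n.+1, ~~ (v <= U)%MS & forall A, S A -> (v *m A - v <= U)%MS.
Proof.
move=> stU nU.
pose Q r := `[< exists W : 'M[K]_n.+1, [/\ \rank W = r, (U <= W)%MS,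
  ~~ (W <= U)%MS & forall A, S A -> (W *m A <= W)%MS] >].
have Q0 : exists r, Q r.
  exists n.+1; apply/asboolP; exists 1%:M; split=> //; first exact: mxrank1.
    exact: submx1.
  by move=> A _; exact: submx1.
have [_ /asboolP[W [<- UW WU stW]] Wmin] := ex_minnP Q0.
have /row_subPn[i wU] := WU; set w := row i W in wU.
have wW : (w <= W)%MS by exact: row_sub.
exists w => // A /I_sub1 Ia.
have -> : w *m A - w = w *m (A - 1) by rewrite mulmxBr mulmx1.
move: {A} (A - 1) Ia => a Ia; apply: contrapT => /negP waU.
(* [P] is the subspace [U + w I]; the matrix [W'] below has it as its row space. *)
pose P (v : 'rV_n.+1) := exists2 b, I b & (v - w *m b <= U)%MS.
have sP : subspace P.
  split=> [|k u v [b Ib ub] [c Ic vc]].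
    by exists 0; [exact: subspace_I.1|rewrite mulmx0 subr0 sub0mx].
  exists (k *: b + c); first exact: subspace_I.2.
  rewrite mulmxDr -scalemxAr opprD addrACA -scalerBr.
  by rewrite addmx_sub // scalemx_sub.
have [W' W'P] := row_subspaceP sP.
have QW' : Q (\rank W').
  apply/asboolP; exists W'; split=> //.
  - apply/rV_subP => v vU; apply/W'P; exists 0; first exact: subspace_I.1.
    by rewrite mulmx0 subr0.
  - apply: contra waU => W'U; apply: submx_trans W'U; apply/W'P.
    by exists a; rewrite ?subrr ?sub0mx.
  move=> B SB; apply/rV_subP => v /submxP[u ->]; rewrite mulmxA.
  have /W'P[b Ib ub] : (u *m W' <= W')%MS by exact: submxMl.
  apply/W'P; exists (b *m B); first exact: I_mulr.
  rewrite mulmxA -mulmxBl; apply: submx_trans (submxMr _ ub) _; exact: stU.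
have W'W : (W' <= W)%MS.
  apply/rV_subP => v /W'P[b [Sb _] vb].
  rewrite -[v](subrK (w *m b)); apply: addmx_sub; first exact: submx_trans UW.
  apply: (Sb (fun b => (w *m b <= W)%MS)) => [|B SB].
    split=> [|k x y Wx Wy]; first by rewrite mulmx0 sub0mx.
    by rewrite mulmxDr -scalemxAr addmx_sub // scalemx_sub.
  by apply: submx_trans (submxMr _ wW) (stW _ SB).
have /W'P[b Ib wb] : (w <= W')%MS.
  apply: (submx_trans wW); rewrite -(geq_leqif (mxrank_leqif_sup W'W)).
  exact: Wmin.
have stab : (U *m b <= U)%MS.
  have [Sb _] := Ib; apply: (Sb (fun b => (U *m b <= U)%MS)) => [|B SB]; last exact: stU.
  split=> [|k x y Wx Wy]; first by rewrite mulmx0 sub0mx.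
  by rewrite mulmxDr -scalemxAr addmx_sub // scalemx_sub.
have bU k : (w - w *m b ^+ k <= U)%MS.
  elim: k => [|k IH]; first by rewrite expr0 mulmx1 subrr sub0mx.
  have -> : w - w *m b ^+ k.+1 = (w - w *m b) + (w - w *m b ^+ k) *m b.
    by rewrite mulmxBl -mulmxA exprSr addrA subrK.
  by apply: addmx_sub => //; apply: submx_trans (submxMr _ IH) _.
have [m bm] := I_nilpotent Ib.
by move: (bU m); rewrite bm mulmx0 subr0 (negPf wU).
Qed.

End KolchinMatrix.

Lemma span_basis (K : fieldType) (V : lmodType K) (s : seq V) :
  exists n (b : 'I_n -> V), lin_free b /\ forall v, in_span s v <-> in_span (codom b) v.
Proof.
have [A [/free_on_enum fA _ sA]] := span_dim_basis s.
exists #|A|, (fun k : 'I_#|A| => s`_(enum_val k)); split=> // v; split.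
  move/sA; apply: in_span_trans => _ /mapP[i iA ->].
  rewrite mem_enum in iA; apply: in_span_mem; apply/codomP.
  by exists (enum_rank_in iA i); rewrite enum_rankK_in.
by apply: in_span_trans => _ /codomP[k ->]; apply/in_span_mem/mem_nth.
Qed.

Section Kolchin.
Variables (K : closedFieldType) (V : lmodType K) (T : set (V -> V)) (H : set V) (s : seq V).
Hypothesis pchar0 : [pchar K] =i pred0.
Hypotheses (T_linear : forall t, T t -> forall k u v, t (k *: u + v) = k *: t u + t v)
  (T_id : T id) (T_comp : forall t t', T t -> T t' -> T (t \o t'))
  (T_unipotent : forall t, T t -> forall v, exists n, iter n (fun u => t u - u) v = 0).
Hypotheses (sH : subspace H) (TH : forall t v, T t -> H v -> H (t v)).
Hypothesis Ts : forall t v, T t -> v \in s -> in_span s (t v).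

(** In a basis of the span of [s], [T] becomes a monoid of unipotent matrices and [H] meets the span
    in the row space of some [U], so [kolchin_mx] applies. *)
Lemma kolchin : (exists2 v, in_span s v & ~ H v) ->
  exists v, [/\ in_span s v, ~ H v & forall t, T t -> H (t v - v)].
Proof.
have [n [b [fb sb]]] := span_basis s.
have t0 t : T t -> t 0 = 0.
  by move=> /T_linear tL; apply: (@addrI _ (t 0)); rewrite -{1}[t 0]scale1r -tL scale1r !addr0.
have tZ t k v : T t -> t (k *: v) = k *: t v.
  by move=> Tt; rewrite -[k *: v]addr0 T_linear // t0 // addr0.
have tsum t I (r : seq I) (F : I -> V) :
    T t -> t (\sum_(i <- r) F i) = \sum_(i <- r) t (F i).
  move=> Tt; elim: r => [|i r IH]; first by rewrite !big_nil t0.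
  by rewrite !big_cons -[F i]scale1r T_linear // IH !scale1r.
(* [kolchin_mx] is about matrices of positive size; an empty basis leaves only the vector 0, which
   lies in [H]. *)
case: n b fb sb => [|n] b fb sb.
  move=> [v /sb /in_span_codomP[c ->]]; rewrite big_ord0 => H0.
  by case: H0; exact: sH.1.
pose phi (c : 'rV[K]_n.+1) := \sum_i c 0 i *: b i.
have phiL k c d : phi (k *: c + d) = k *: phi c + phi d.
  rewrite /phi scaler_sumr -big_split; apply: eq_bigr => i _.
  by rewrite !mxE scalerDl scalerA.
have phi00 : phi 0 = 0 by rewrite /phi big1 // => i _; rewrite mxE scale0r.
have phiZ k c : phi (k *: c) = k *: phi c by rewrite -[k *: c]addr0 phiL phi00 addr0.
have phiB c d : phi (c - d) = phi c - phi d.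
  by rewrite -[- d]scaleN1r addrC phiL scaleN1r addrC.
have phi0 c : phi c = 0 -> c = 0.
  by move=> /fb c0; apply/rowP => i; rewrite c0 mxE.
have phi_span c : in_span s (phi c) by apply/sb/in_span_codomP; exists (c 0).
have phi_surj v : in_span s v -> exists c, v = phi c.
  move/sb/in_span_codomP => [c ->]; exists (\row_i c i).
  by apply: eq_bigr => i _; rewrite mxE.
have t_span t v : T t -> in_span s v -> in_span s (t v).
  move=> Tt; apply: (@in_span_sub _ _ (fun u => in_span s (t u))) => [|u]; last exact: Ts.
  split=> [|k u w]; first by rewrite t0 //; exact: (in_span_subspace s).1.
  by rewrite T_linear //; exact: (in_span_subspace s).2.
pose mx_of t (A : 'M[K]_n.+1) := forall c, phi (c *m A) = t (phi c).
have mx_of_ex t : T t -> exists A, mx_of t A.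
  move=> Tt; have tb i : exists c, t (b i) = phi c.
    by apply/phi_surj/t_span => //; apply/sb/in_span_mem/codom_f.
  pose c i := projT1 (cid (tb i)); have cE i : t (b i) = phi (c i) by rewrite /c; case: cid.
  exists (\matrix_i c i) => d; rewrite mulmx_sum_row {2}/phi tsum //.
  have phi_sum (r : seq 'I_n.+1) (F : 'I_n.+1 -> 'rV[K]_n.+1) :
      phi (\sum_(i <- r) F i) = \sum_(i <- r) phi (F i).
    elim: r => [|i r IH]; first by rewrite !big_nil.
    by rewrite !big_cons -[F i]scale1r phiL IH !scale1r.
  by rewrite phi_sum; apply: eq_bigr => i _; rewrite tZ // cE rowK phiZ.
pose S A := exists2 t, T t & mx_of t A.
have S1 : S 1 by exists id => // c; rewrite mulmx1.
have SM A B : S A -> S B -> S (A * B).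
  move=> [t Tt tA] [u Tu uB]; exists (u \o t); first exact: T_comp.
  by move=> c; rewrite mulmxA uB tA.
have phi_iter t A k c : mx_of t A -> phi (c *m (A - 1) ^+ k) = iter k (fun u => t u - u) (phi c).
  move=> tA; elim: k => [|k IH]; first by rewrite expr0 mulmx1.
  by rewrite iterS -IH exprSr mulmxA mulmxBr mulmx1 phiB tA.
have S_unipotent A : S A -> exists k, (A - 1) ^+ k = 0.
  move=> [t Tt tA]; pose k i := projT1 (cid (T_unipotent Tt (b i))).
  have kP i : iter (k i) (fun u => t u - u) (b i) = 0 by rewrite /k; case: cid.
  have iter0 j : iter j (fun u => t u - u) 0 = 0.
    by elim: j => // j /= ->; rewrite t0 // subr0.
  exists (\max_i k i); apply/row_matrixP => i; rewrite row0 rowE; apply: phi0.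
  rewrite (phi_iter t) //.
  have -> : phi (delta_mx 0 i) = b i.
    rewrite /phi (bigD1 i) //= mxE !eqxx scale1r big1 ?addr0 // => j /negPf ji.
    by rewrite mxE ji andbF scale0r.
  by rewrite -(subnK (leq_bigmax i)) iterD kP iter0.
have [U UP] : exists U : 'M[K]_n.+1, forall c : 'rV_n.+1, (c <= U)%MS <-> H (phi c).
  apply: (row_subspaceP (P := fun c => H (phi c))); split=> [|k c d].
    by rewrite phi00; exact: sH.1.
  by rewrite phiL; exact: sH.2.
move=> [_ /phi_surj[c0 ->] Hc0].
have [A [t Tt tA]||c cU cS] := kolchin_mx pchar0 S1 SM S_unipotent (U := U).
- apply/rV_subP => v /submxP[d ->]; rewrite mulmxA; apply/UP; rewrite tA.
  by apply: TH => //; apply/UP; exact: submxMl.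
- by apply/negP => U1; apply/Hc0/UP; apply: submx_trans U1; exact: submx1.
exists (phi c); split; first exact: phi_span.
  by move/UP; apply/negP.
move=> t Tt; have [A tA] := mx_of_ex t Tt.
have /UP : (c *m A - c <= U)%MS by apply: cS; exists t.
by rewrite phiB tA.
Qed.

End Kolchin.

(** * Translations *)

Section LocallyNilpotent.
Variables (V : zmodType) (A B : {additive V -> V}).
Hypotheses (AB : forall v, A (B v) = B (A v)).
Hypotheses (nilA : forall v, exists n, iter n A v = 0) (nilB : forall v, exists n, iter n B v = 0).

Lemma locally_nilpotentD v : exists n, iter n (fun u => A u + B u) v = 0.
Proof.
have [m] := nilA v; elim: m v => [|m IH] v Av; first by exists 0.
have iterf0 (f : {additive V -> V}) j : iter j f 0 = 0.
  by elim: j => //= j ->; rewrite raddf0.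
have iterA j u w : iter j A (u + w) = iter j A u + iter j A w.
  by elim: j => //= j ->; rewrite raddfD.
have iterAB j u : iter j A (B u) = B (iter j A u) by elim: j => //= j ->.
have [n Bv] := nilB v.
(* (A + B)^n v is B^n v = 0 up to an element of the range of A killed by A^m. *)
have [u [E u0]] : exists u, iter n (fun u => A u + B u) v = iter n B v + A u /\ iter m.+1 A u = 0.
  elim: n {Bv} => [|n [u [E u0]]]; first by exists 0; rewrite raddf0 addr0 iterf0.
  exists (iter n B v + (A u + B u)); split.
    by rewrite !iterS E !raddfD /= AB -!addrA [RHS]addrCA; congr (_ + _); rewrite addrCA.
  have AAu : iter m.+1 A (A u) = 0 by rewrite -iterSr iterS u0 raddf0.
  rewrite !iterA iterAB u0 AAu raddf0 !addr0.
  have -> : iter m.+1 A (iter n B v) = iter n B (iter m.+1 A v).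
    by elim: n {E} => // n IHn; rewrite (iterS n B) iterAB IHn.
  by rewrite Av iterf0.
rewrite Bv add0r in E; have [|k Ek] := IH (A u); first by rewrite -iterSr.
by exists (k + n)%N; rewrite iterD E.
Qed.

End LocallyNilpotent.

Section Translations.
Variables (K : closedFieldType) (G : affAlgGroup K).
Local Notation O := (Defs.coord G).
Implicit Types (g h x y z : G) (a b f : O).

Lemma Delta2E x y z a : ev (x * y * z)%g a =
  \sum_(p <- Delta2 a) ev x p.1.1 * ev y p.1.2 * ev z p.2 :> K.
Proof.
rewrite -mulgA DeltaE big_allpairs_dep; apply: eq_bigr => p _.
by rewrite DeltaE mulr_sumr; apply: eq_bigr => q _; rewrite mulrA.
Qed.

(** The two-sided translate [y |-> f (g * y * h)], see [ev_trans]. *)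
Definition trans g h f : O := \sum_(p <- Delta2 f) (ev g p.1.1 * ev h p.2) *: p.1.2.

Lemma ev_trans g h f y : ev y (trans g h f) = ev (g * y * h)%g f :> K.
Proof.
rewrite Delta2E ev_sum; apply: eq_bigr => p _.
by rewrite evZ mulrAC.
Qed.

Fact trans_is_linear g h : linear (trans g h).
Proof. by move=> k a b; apply: coord_ext => x; rewrite evD evZ !ev_trans evD evZ. Qed.

Fact trans_is_monoid_morphism g h : monoid_morphism (trans g h).
Proof.
split=> [|a b]; apply: coord_ext => x; first by rewrite ev_trans !ev1.
by rewrite evM !ev_trans evM.
Qed.

HB.instance Definition _ g h := GRing.isLinear.Build K O O *:%R (trans g h) (trans_is_linear g h).
HB.instance Definition _ g h :=
  GRing.isMonoidMorphism.Build O O (trans g h) (trans_is_monoid_morphism g h).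

Lemma trans_id f : trans 1%g 1%g f = f.
Proof. by apply: coord_ext => x; rewrite ev_trans mul1g mulg1. Qed.

Lemma trans_comp g h g' h' f : trans g h (trans g' h' f) = trans (g' * g)%g (h * h')%g f.
Proof. by apply: coord_ext => x; rewrite !ev_trans !mulgA. Qed.

Lemma trans_const k g h : trans g h k%:A = k%:A.
Proof. by rewrite linearZ /= rmorph1. Qed.

Lemma trans_invariant f : (forall g h, trans g h f = f) -> exists k, f = k%:A.
Proof.
move=> inv; exists (ev 1%g f); apply: coord_ext => x.
rewrite -{1}(inv x^-1%g 1%g) ev_trans mulVg mulg1 evZ ev1 mulr1; reflexivity.
Qed.

Hypothesis uG : unipotent G.

(** With [L] the left translation by [g] and [R] the right translation by [h], [R L - 1] is the sum
    of [R (L - 1)] and [R - 1], which commute and are locally nilpotent. *)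
Lemma trans_unipotent g h f : exists n, iter n (fun u => trans g h u - u) f = 0.
Proof.
have trans1R h' u : trans 1%g h' u = rtrans h' u.
  by apply: coord_ext => x; rewrite ev_trans ev_rtrans mul1g.
have unR u : exists n, iter n (fun u => trans 1%g h u - u) u = 0.
  have [n En] := uG h u; exists n; rewrite -[RHS]En.
  by apply: eq_iter => w; rewrite trans1R.
have unL u : exists n, iter n (fun u => trans g 1%g u - u) u = 0.
  (* Inversion on the group turns left translation by [g] into right translation by [g^-1], to which
     unipotence applies. *)
  have [u' uE] := coord_inv u; have [n En] := uG g^-1%g u'.
  exists n; apply: coord_ext => y.
  transitivity (ev y^-1%g (iter n (fun w => rtrans g^-1%g w - w) u') : K); last by rewrite En !ev0.
  elim: n y {En} => [|n IH] y; first by rewrite /= uE invgK.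
  by rewrite !iterS !evB ev_trans ev_rtrans mulg1 !IH invgM.
pose A u := trans g h u - trans 1%g h u; pose B u := trans 1%g h u - u.
have aA : zmod_morphism A by move=> u v; rewrite /A !raddfB /=; ring.
have aB : zmod_morphism B by move=> u v; rewrite /B !raddfB /=; ring.
pose A' : {additive O -> O} := HB.pack A (GRing.isZmodMorphism.Build O O A aA).
pose B' : {additive O -> O} := HB.pack B (GRing.isZmodMorphism.Build O O B aB).
have [||| n En] := @locally_nilpotentD O A' B' _ _ _ f.
- by move=> u /=; rewrite /A /B !raddfB /= !trans_comp !mul1g !mulg1; ring.
- move=> u; have [n En] := unL u; exists n.
  have -> : iter n A' u = iter n (trans 1%g h) (iter n (fun u => trans g 1%g u - u) u).
    have L w : A' w = trans 1%g h (trans g 1%g w - w).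
      by rewrite /= /A raddfB /= trans_comp !mulg1.
    have C j w : iter j (trans 1%g h) (trans g 1%g w - w) =
                 (fun u => trans g 1%g u - u) (iter j (trans 1%g h) w).
      by elim: j => //= j ->; rewrite !raddfB /= !trans_comp !mulg1 !mul1g.
    by elim: n {En} => // n IH; rewrite iterS IH L iterS iterS C.
  by rewrite En; elim: n {En} => //= n ->; rewrite raddf0.
- exact: unR.
by exists n; rewrite -[RHS]En; apply: eq_iter => u; rewrite /= /A /B addrA subrK.
Qed.

End Translations.

(** * Translates and twisted products as finite combinations of fixed translates *)

Section Interpolation.
Variables (K : closedFieldType) (G : affAlgGroup K).
Local Notation O := (Defs.coord G).
Implicit Types (g h x y z : G) (a b f : O).

(* The coefficients of the combinations do not depend on a and b: t comes from
   interpolating the outer components of Delta2 at finitely many points. *)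
Lemma trans_interp (s : seq O) : exists t : seq (G * O),
  (forall a, a \in s -> forall g h, trans g h a =
     \sum_(i <- t) \sum_(k <- t) (ev g i.2 * ev h k.2) *: trans i.1 k.1 a) /\
  (forall (J : hopf2cocycle G) a b, a \in s -> b \in s -> tmul J a b =
     \sum_(i <- t) \sum_(k <- t) \sum_(i' <- t) \sum_(k' <- t)
       (cocycleV J i.2 i'.2 * J k.2 k'.2) *: (trans i.1 k.1 a * trans i'.1 k'.1 b)).
Proof.
pose L := flatten [seq [seq p.1.1 | p <- Delta2 a] ++ [seq p.2 | p <- Delta2 a] | a <- s].
have [t tE] := interp L.
have E (f1 f3 : O -> K) a : lin f1 -> lin f3 -> a \in s ->
    \sum_(p <- Delta2 a) (f1 p.1.1 * f3 p.2) *: p.1.2 =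
    \sum_(i <- t) \sum_(k <- t) (f1 i.2 * f3 k.2) *: trans i.1 k.1 a.
  move=> L1 L3 sa; rewrite /trans.
  under [RHS]eq_bigr do under eq_bigr do rewrite scaler_sumr.
  under [RHS]eq_bigr do rewrite exchange_big /=.
  rewrite exchange_big /=; apply: eq_big_seq => p pa.
  have mem q : q \in [seq p.1.1 | p <- Delta2 a] ++ [seq p.2 | p <- Delta2 a] -> q \in L.
    by move=> qa; apply/flatten_mapP; exists a.
  have m1 : p.1.1 \in L.
    by apply: mem; rewrite mem_cat; apply/orP; left; apply/mapP; exists p.
  have m3 : p.2 \in L.
    by apply: mem; rewrite mem_cat; apply/orP; right; apply/mapP; exists p.
  rewrite (lin_interp L1 tE m1) (lin_interp L3 tE m3) mulr_suml scaler_suml.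
  apply: eq_bigr => i _; rewrite mulr_sumr scaler_suml; apply: eq_bigr => k _.
  by rewrite scalerA; congr (_ *: _); rewrite mulrACA mulrC.
exists t; split=> [a sa g h|J a b sa sb].
  by rewrite -(E (fun a => ev g a) (fun a => ev h a)) //; exact: lin_ev.
have [[V1 V2] [J1 J2]] := (bil_biscalar (cocycleV J), bil_biscalar J).
rewrite /tmul.
transitivity (\sum_(p <- Delta2 a) \sum_(i' <- t) \sum_(k' <- t)
   (cocycleV J p.1.1 i'.2 * J p.2 k'.2) *: (p.1.2 * trans i'.1 k'.1 b)).
  apply: eq_bigr => p _; under eq_bigr do rewrite scalerAr.
  rewrite -mulr_sumr (E _ _ _ (V2 _) (J2 _) sb) mulr_sumr; apply: eq_bigr => i _.
  by rewrite mulr_sumr; apply: eq_bigr => k _; rewrite scalerAr.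
rewrite exchange_big /= [RHS](eq_bigr (fun i => \sum_(i' <- t) \sum_(k <- t) \sum_(k' <- t)
       (cocycleV J i.2 i'.2 * J k.2 k'.2) *: (trans i.1 k.1 a * trans i'.1 k'.1 b))); last first.
  by move=> i _; rewrite exchange_big.
rewrite [RHS]exchange_big; apply: eq_bigr => i' _ /=.
rewrite exchange_big /= [RHS](eq_bigr (fun i => \sum_(k' <- t) \sum_(k <- t)
       (cocycleV J i.2 i'.2 * J k.2 k'.2) *: (trans i.1 k.1 a * trans i'.1 k'.1 b))); last first.
  by move=> i _; rewrite exchange_big.
rewrite [RHS]exchange_big; apply: eq_bigr => k' _ /=.
under eq_bigr do rewrite scalerAl.
rewrite -mulr_suml (E _ _ _ (V1 _) (J1 _) sa) mulr_suml; apply: eq_bigr => i _.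
by rewrite mulr_suml; apply: eq_bigr => k _; rewrite scalerAl.
Qed.

End Interpolation.

(** * Towers of polynomial extensions *)

Section XaddCPowers.
Variables (R : comNzRingType) (c : R).

Lemma size_exp_XaddC n : (size (('X + c%:P) ^+ n) <= n.+1)%N.
Proof. by apply: leq_trans (size_poly_exp_leq _ _) _; rewrite size_XaddC mul1n. Qed.

Lemma coef_exp_XaddC n : (('X + c%:P) ^+ n)`_n = 1.
Proof.
elim: n => [|n IH]; first by rewrite expr0 coef1.
rewrite exprS mulrDl coefD coefXM coefCM /= IH.
by rewrite [X in c * X]nth_default ?size_exp_XaddC // mulr0 addr0.
Qed.

Lemma coef_exp_XaddC_pred n : (('X + c%:P) ^+ n.+1)`_n = n.+1%:R * c.
Proof.
elim: n => [|n IH]; first by rewrite expr1 coefD coefX coefC add0r mul1r.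
rewrite exprS mulrDl coefD coefXM coefCM /= IH coef_exp_XaddC mulr1.
by rewrite -[in RHS]natr1 mulrDl mul1r.
Qed.

Lemma comp_poly_wide m (p q : {poly R}) : (size p <= m)%N ->
  p \Po q = \sum_(i < m) p`_i *: q ^+ i.
Proof.
move=> pm; rewrite comp_polyE (big_ord_widen m (fun i => p`_i *: q ^+ i)) // big_mkcond /=.
by apply: eq_bigr => i _; case: ltnP => // ?; rewrite nth_default // scale0r.
Qed.

End XaddCPowers.

Section Towers.
Variables (K : closedFieldType) (G : affAlgGroup K).
Local Notation O := (Defs.coord G).
Implicit Types (g h : G) (a b f x : O) (H W : set O) (p q : {poly O}).

Definition stable W : Prop := forall g h f, W f -> W (trans g h f).

Definition stable_subalg H : Prop :=
  [/\ subspace H, H 1, forall a b, H a -> H b -> H (a * b) & stable H].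

Definition poly_in W p : Prop := forall i, W p`_i.

Definition adjoin H x : set O := [set f | exists2 p, poly_in H p & f = p.[x]].

Inductive tower : nat -> set O -> Prop :=
| tower0 : tower 0 [set f | exists k, f = k%:A]
| towerS d H x : tower d H -> (forall g h, H (trans g h x - x)) ->
    (forall p, poly_in H p -> p.[x] = 0 -> p = 0) -> tower d.+1 (adjoin H x).

Section Polynomials.
Variable H : set O.
Hypothesis sH : stable_subalg H.

Lemma subalg0 : H 0. Proof. by case: sH => -[]. Qed.

Lemma subalgD a b : H a -> H b -> H (a + b).
Proof. by case: sH => sW _ _ _; apply: subspaceD. Qed.

Lemma subalgB a b : H a -> H b -> H (a - b).
Proof. by case: sH => sW _ _ _; apply: subspaceB. Qed.

Lemma subalgZ k a : H a -> H (k *: a).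
Proof. by case: sH => sW _ _ _; apply: subspaceZ. Qed.

Lemma subalg1 : H 1. Proof. by case: sH. Qed.

Lemma subalgM a b : H a -> H b -> H (a * b).
Proof. by case: sH => _ _ + _; apply. Qed.

Lemma subalg_trans g h a : H a -> H (trans g h a).
Proof. by case: sH => _ _ _ +; apply. Qed.

Lemma poly_inC c : H c -> poly_in H c%:P.
Proof. by move=> Hc i; rewrite coefC; case: ifP => // _; exact: subalg0. Qed.

Lemma poly_inX : poly_in H 'X.
Proof. by move=> i; rewrite coefX; case: (_ == _); [exact: subalg1|exact: subalg0]. Qed.

Lemma poly_inD p q : poly_in H p -> poly_in H q -> poly_in H (p + q).
Proof. by move=> Hp Hq i; rewrite coefD; exact: subalgD. Qed.

Lemma poly_inB p q : poly_in H p -> poly_in H q -> poly_in H (p - q).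
Proof. by move=> Hp Hq i; rewrite coefB; exact: subalgB. Qed.

Lemma poly_inM p q : poly_in H p -> poly_in H q -> poly_in H (p * q).
Proof.
move=> Hp Hq i; rewrite coefM; case: sH => sW _ _ _; apply: subspace_sum => // j _.
exact: subalgM.
Qed.

Lemma poly_in_exp p n : poly_in H p -> poly_in H (p ^+ n).
Proof.
move=> Hp; elim: n => [|n IH]; first by rewrite expr0; exact/poly_inC/subalg1.
by rewrite exprS; exact: poly_inM.
Qed.

Lemma poly_in_scale c p : H c -> poly_in H p -> poly_in H (c *: p).
Proof. by move=> Hc Hp i; rewrite coefZ; exact: subalgM. Qed.

Lemma poly_in_sum (I : Type) (r : seq I) (F : I -> {poly O}) :
  (forall i, poly_in H (F i)) -> poly_in H (\sum_(i <- r) F i).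
Proof.
move=> HF i; rewrite coef_sum; case: sH => sW _ _ _; apply: subspace_sum => // j _.
exact: HF.
Qed.

Lemma sub_adjoin x f : H f -> adjoin H x f.
Proof. by move=> Hf; exists f%:P; [exact: poly_inC|rewrite hornerC]. Qed.

Lemma adjoin_gen x : adjoin H x x.
Proof. by exists 'X; [exact: poly_inX|rewrite hornerX]. Qed.

(** The lift of a translation to polynomials in [x]: coefficients are translated and ['X] is shifted
    by the increment of [x]. The top coefficient is therefore only translated, see
    [coef_poly_trans]. *)
Definition poly_trans x g h p : {poly O} :=
  map_poly (trans g h) p \Po ('X + (trans g h x - x)%:P).

Lemma horner_poly_trans x g h p : (poly_trans x g h p).[x] = trans g h p.[x].
Proof. by rewrite horner_comp hornerD hornerX hornerC addrC subrK horner_map. Qed.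

Lemma poly_transE x g h m p : (size p <= m)%N -> poly_trans x g h p =
  \sum_(i < m) trans g h p`_i *: ('X + (trans g h x - x)%:P) ^+ i.
Proof.
move=> pm; rewrite /poly_trans (@comp_poly_wide _ m); last first.
  by rewrite /map_poly; apply: leq_trans (size_poly _ _) pm.
by apply: eq_bigr => i _; rewrite coef_map.
Qed.

Lemma size_poly_trans x g h m p : (size p <= m)%N -> (size (poly_trans x g h p) <= m)%N.
Proof.
move=> pm; rewrite (poly_transE _ _ _ pm); apply: leq_trans (size_sum _ _ _) _.
apply/bigmax_leqP => i _; apply: leq_trans (size_scale_leq _ _) _.
by apply: leq_trans (size_exp_XaddC _ _) _.
Qed.

Lemma coef_poly_trans x g h m p : (size p <= m.+1)%N ->
  (poly_trans x g h p)`_m = trans g h p`_m.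
Proof.
move=> pm; rewrite (poly_transE _ _ _ pm) big_ord_recr coefD coefZ coef_exp_XaddC mulr1.
rewrite coef_sum big1 ?add0r // => i _.
by rewrite coefZ [X in _ * X]nth_default ?mulr0 //; exact: leq_trans (size_exp_XaddC _ _) (ltn_ord i).
Qed.

(** The second term comes from the binomial expansion of the top power. Its factor [m.+1%:R] is
    where characteristic 0 enters in [adjoin_free]. *)
Lemma coef_poly_trans_pred x g h m p : (size p <= m.+2)%N ->
  (poly_trans x g h p)`_m = trans g h p`_m + trans g h p`_m.+1 * (m.+1%:R * (trans g h x - x)).
Proof.
move=> pm; rewrite (poly_transE _ _ _ pm) big_ord_recr coefD coefZ coef_exp_XaddC_pred.
congr (_ + _); rewrite big_ord_recr coefD coefZ coef_exp_XaddC mulr1.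
rewrite coef_sum big1 ?add0r // => i _.
by rewrite coefZ [X in _ * X]nth_default ?mulr0 //; exact: leq_trans (size_exp_XaddC _ _) (ltn_ord i).
Qed.

Lemma poly_in_trans x g h p :
  H (trans g h x - x) -> poly_in H p -> poly_in H (poly_trans x g h p).
Proof.
move=> Hx Hp; rewrite (poly_transE _ _ _ (leqnn _)); apply: poly_in_sum => i.
apply: poly_in_scale; first exact/subalg_trans/Hp.
by apply/poly_in_exp/poly_inD; [exact: poly_inX|exact: poly_inC].
Qed.

Lemma stable_subalg_adjoin x :
  (forall g h, H (trans g h x - x)) -> stable_subalg (adjoin H x).
Proof.
move=> Hx; split.
- split=> [|k _ _ [p Hp ->] [q Hq ->]]; first exact/sub_adjoin/subalg0.
  exists (k%:A *: p + q); last by rewrite hornerD hornerZ -scalerAl mul1r.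
  by apply: poly_inD => //; apply: poly_in_scale => //; exact/subalgZ/subalg1.
- exact/sub_adjoin/subalg1.
- move=> _ _ [p Hp ->] [q Hq ->]; exists (p * q); last by rewrite hornerM.
  exact: poly_inM.
- move=> g h _ [p Hp ->]; exists (poly_trans x g h p); first exact: poly_in_trans.
  by rewrite horner_poly_trans.
Qed.

End Polynomials.

Lemma stable_subalg_const : stable_subalg [set f : O | exists k, f = k%:A].
Proof.
split.
- split=> [|k _ _ [a ->] [b ->]]; first by exists 0; rewrite scale0r.
  by exists (k * a + b); rewrite scalerDl scalerA.
- by exists 1; rewrite scale1r.
- by move=> _ _ [a ->] [b ->]; exists (a * b); rewrite -scalerAl mul1r scalerA.
- by move=> g h _ [a ->]; exists a; rewrite trans_const.
Qed.

Lemma tower_stable d H : tower d H -> stable_subalg H.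
Proof.
by elim=> [|{}d {}H x _ sH Hx _]; [exact: stable_subalg_const|exact: stable_subalg_adjoin].
Qed.

End Towers.

Lemma words_sub (A : nzRingType) (W : set A) (s : seq A) n w :
  W 1 -> (forall a b, W a -> W b -> W (a * b)) -> (forall v, v \in s -> W v) ->
  w \in words s n -> W w.
Proof.
move=> W1 WM Ws; elim: n w => [|n IH] w /=; first by rewrite inE => /eqP->.
rewrite inE => /orP[/eqP->//|/allpairsP[[a b] /= [/Ws Wa /IH Wb ->]]].
exact: WM.
Qed.

Lemma lin_free_option (K : fieldType) (V : lmodType K) (H : set V) (I : finType) (e : I -> V) x :
  subspace H -> (forall i, H (e i)) -> ~ H x -> lin_free e ->
  lin_free (fun o : option I => if o is Some i then e i else x).
Proof.
move=> sH He nHx fe c; rewrite (bigD1 None) //= (reindex_omap Some id) /=; last by case.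
rewrite (eq_bigl xpredT); last by move=> i; rewrite eqxx.
move=> E; have c0 : c None = 0.
  apply/eqP/negPn/negP => c0; apply: nHx.
  have -> : x = - (c None)^-1 *: \sum_i c (Some i) *: e i.
    move/eqP: E; rewrite addrC addr_eq0 => /eqP->.
    by rewrite scalerN scaleNr opprK scalerA mulVf // scale1r.
  apply: subspaceZ => //; apply: subspace_sum => // i _; exact: subspaceZ.
by case=> // i; apply: (fe (fun i => c (Some i))); rewrite c0 scale0r add0r in E.
Qed.

(** * Existence of a tower that reaches the whole of O(G) *)

Section TowerExistence.
Variables (K : closedFieldType) (G : affAlgGroup K).
Local Notation O := (Defs.coord G).
Implicit Types (g h : G) (a b f x : O) (H W : set O) (p q : {poly O}).
Hypothesis pchar0 : [pchar K] =i pred0.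
Hypothesis uG : unipotent G.

Lemma unipotent_fixed (s : seq O) H : subspace H -> stable H ->
  (forall v, v \in s -> forall g h, in_span s (trans g h v)) ->
  (exists2 v, in_span s v & ~ H v) ->
  exists x, [/\ in_span s x, ~ H x & forall g h, H (trans g h x - x)].
Proof.
move=> sH stH ss ex.
pose T := [set t : O -> O | exists g h, t = trans g h].
have [||||| |x [sx Hx Tx]] := @kolchin K O T H s pchar0 _ _ _ _ sH _ _ ex.
- by move=> _ [g [h ->]] k u v; rewrite linearP.
- by exists 1%g, 1%g; apply/funext => f; rewrite trans_id.
- move=> _ _ [g [h ->]] [g' [h' ->]]; exists (g' * g)%g, (h * h')%g.
  by apply/funext => f /=; rewrite trans_comp.
- by move=> _ [g [h ->]]; exact: trans_unipotent.
- by move=> _ v [g [h ->]]; exact: stH.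
- by move=> _ v [g [h ->]] sv; exact: ss.
by exists x; split=> // g h; apply: Tx; exists g, h.
Qed.

(** O(G) is locally finite: by [trans_interp] all translates of [s] are combinations of finitely
    many of them. These are taken as [s'], which thus stays in any stable [W] that contains [s]. *)
Lemma stable_span (s : seq O) : exists s', [/\ forall v, v \in s -> in_span s' v,
  forall v, v \in s' -> forall g h, in_span s' (trans g h v) &
  forall W, stable W -> (forall v, v \in s -> W v) -> forall v, v \in s' -> W v].
Proof.
have [t [tE _]] := trans_interp s.
pose s' := flatten [seq [seq trans i.1 k.1 a | i <- t, k <- t] | a <- s].
have sP v : v \in s' -> exists2 a, a \in s & exists g h, v = trans g h a.
  by case/flatten_mapP => a sa /allpairsP[[i k] /= [_ _ ->]]; exists a => //; exists i.1, k.1.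
have s'P a g h : a \in s -> in_span s' (trans g h a).
  move=> sa; rewrite tE //.
  apply: (subspace_sum_seq (in_span_subspace _)) => i ti.
  apply: (subspace_sum_seq (in_span_subspace _)) => k tk.
  apply: (subspaceZ _ (in_span_subspace _)); apply: in_span_mem.
  by apply/flatten_mapP; exists a => //; apply: allpairs_f.
exists s'; split=> [v sv|v /sP[a sa [g' [h' ->]]] g h|W stW Ws v /sP[a sa [g [h ->]]]].
- by rewrite -(trans_id v); exact: s'P.
- by rewrite trans_comp; exact: s'P.
- by apply/stW/Ws.
Qed.

(** Kolchin's theorem modulo the zero subspace yields a nonzero invariant element of [W], and an
    invariant function is constant. *)
Lemma stable_has_one W a : subspace W -> stable W -> W a -> a != 0 -> W 1.
Proof.
move=> sW stW Wa a0; have [s [as_ ss sub]] := stable_span [:: a].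
have [|||x [sx x0 xinv]] := @unipotent_fixed s [set 0] _ _ ss _.
- by split=> // k _ _ -> ->; rewrite scaler0 addr0.
- by move=> g h _ ->; exact: raddf0.
- by exists a; [apply: as_; rewrite mem_head|apply/eqP].
have [k xk] : exists k, x = k%:A.
  by apply: trans_invariant => g h; apply/eqP; rewrite -subr_eq0; apply/eqP/xinv.
have Wx : W x.
  apply: in_span_sub sx => // u; apply: sub => // v; by rewrite inE => /eqP->.
have k0 : k != 0 by apply/eqP => k0; apply: x0; rewrite xk k0 scale0r.
by rewrite -[1]scale1r -(mulVf k0) -scalerA -xk; exact: subspaceZ.
Qed.

(* If x satisfied a relation over H, one of minimal degree m could be chosen
   monic, as its possible leading coefficients form a stable subspace.  It is
   then invariant under translation, hence so is m x + p_(m-1), which makes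
   x an element of H. *)
Lemma adjoin_free H x : stable_subalg H -> (forall g h, H (trans g h x - x)) -> ~ H x ->
  forall p, poly_in H p -> p.[x] = 0 -> p = 0.
Proof.
move=> sH Hx nHx p0 Hp0 rp0; apply/eqP/negPn/negP => p0n0.
pose Q n := `[< exists p, [/\ poly_in H p, p.[x] = 0, p != 0 & size p = n] >].
have exQ : exists n, Q n by exists (size p0); apply/asboolP; exists p0.
have [n /asboolP[{p0 Hp0 rp0 p0n0}p [Hp rp pn0 szp]] minn] := ex_minnP exQ.
have small q : poly_in H q -> q.[x] = 0 -> (size q < n)%N -> q = 0.
  move=> Hq rq; apply: contraTeq => q0; rewrite -leqNgt; apply: minn.
  by apply/asboolP; exists q.
case: n szp minn small {exQ} => [|[|m]] szp minn small.
- by move/eqP: szp pn0; rewrite size_poly_eq0 => /eqP->; rewrite eqxx.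
- have pC := size1_polyC (eq_leq szp).
  by move: rp pn0; rewrite pC hornerC => ->; rewrite eqxx.
pose I := [set c | exists q, [/\ poly_in H q, q.[x] = 0, (size q <= m.+2)%N & q`_m.+1 = c]].
have sI : subspace I.
  split=> [|k _ _ [q [Hq rq sq <-]] [q' [Hq' rq' sq' <-]]].
    exists 0; rewrite horner0 size_poly0 coef0; split=> //.
    by move=> i; rewrite coef0; exact: subalg0.
  exists (k%:A *: q + q'); split.
  - apply: poly_inD => //; apply: poly_in_scale => //.
    by apply: subalgZ => //; exact: subalg1.
  - by rewrite hornerD hornerZ rq rq' mulr0 addr0.
  - apply: leq_trans (size_polyD _ _) _; rewrite geq_max sq' andbT.
    exact: leq_trans (size_scale_leq _ _) sq.
  - by rewrite coefD coefZ -scalerAl mul1r.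
have stI : stable I.
  move=> g h _ [q [Hq rq sq <-]]; exists (poly_trans x g h q); split.
  - exact: poly_in_trans.
  - by rewrite horner_poly_trans rq raddf0.
  - exact: size_poly_trans.
  - exact: coef_poly_trans.
have lp0 : p`_m.+1 != 0 by rewrite -[m.+1]/(m.+2.-1) -szp -lead_coefE lead_coef_eq0.
have Ip : I p`_m.+1 by exists p; rewrite szp.
have [q [Hq rq sq q1]] := stable_has_one sI stI Ip lp0.
(* Both polynomials have top coefficient 1, so their difference is a relation of smaller degree,
   which vanishes by minimality. *)
have inv g h : poly_trans x g h q = q.
  apply/eqP; rewrite -subr_eq0; apply/eqP/small.
  - by apply: poly_inB => //; exact: poly_in_trans.
  - by rewrite hornerD hornerN horner_poly_trans rq raddf0 subrr.
  rewrite ltnS; apply/leq_sizeP => j; rewrite leq_eqVlt => /orP[/eqP<-|mj].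
    by rewrite coefB coef_poly_trans // q1 rmorph1 subrr.
  by rewrite coefB !nth_default ?subrr //; [exact: leq_trans mj|apply/(leq_trans _ mj)/size_poly_trans].
have [k yk] : exists k, m.+1%:R *: x + q`_m = k%:A.
  apply: trans_invariant => g h; have /(congr1 (fun p : {poly O} => p`_m)) := inv g h.
  rewrite coef_poly_trans_pred // q1 rmorph1 mul1r => E.
  rewrite raddfD /= linearZ /= -[in RHS]E addrC.
  by rewrite !scaler_nat mulr_natl mulrnBl addrCA [X in _ = _ + X]addrC subrK.
apply: nHx; have m0 : m.+1%:R != 0 :> K by rewrite ((pcharf0P K).1 pchar0).
have -> : x = m.+1%:R^-1 *: (k%:A - q`_m) by rewrite -yk addrK scalerA mulVf // scale1r.
by apply: subalgZ => //; apply: subalgB => //; apply: subalgZ => //; exact: subalg1.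
Qed.

(** Some finite [s] generates O(G) and has a stable span. Each step adjoins an element of this span
    outside [H], so after [n] steps either [s] lies in [H] or [H] contains [n] independent elements
    of the span. The latter is impossible once [n] exceeds the size of [s]. *)
Lemma tower_exists : exists d, tower d (@setT O).
Proof.
have [s0 s0P] := coord_fg G; have [s [s0s ss _]] := stable_span s0.
have step n : exists d H, tower d H /\ ((forall v, v \in s -> H v) \/
    exists (I : finType) (e : I -> O),
      [/\ #|I| = n, lin_free e & forall i, H (e i) /\ in_span s (e i)]).
  elim: n => [|n [d [H [tH [sH|[I [e [In fe He]]]]]]]].
  - exists 0%N, [set f | exists k, f = k%:A]; split; first exact: tower0.
    by right; exists void, (of_void O); split; [exact: card_void|move=> c _ []|case].
  - by exists d, H; split=> //; left.
  have stH := tower_stable tH; have [sH _ _ HT] := stH.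
  have [sub|nsub] := pselect (forall v, v \in s -> H v); first by exists d, H; split=> //; left.
  have [|x [sx nHx Hx]] := unipotent_fixed sH HT ss.
    apply: contrapT => nex; apply: nsub => v sv; apply: contrapT => nHv; apply: nex.
    by exists v => //; exact: in_span_mem.
  exists d.+1, (adjoin H x); split; first exact: towerS (adjoin_free stH Hx nHx).
  right; exists (option I), (fun o => if o is Some i then e i else x); split.
  - by rewrite card_option In.
  - by apply: (lin_free_option sH _ nHx fe) => i; case: (He i).
  - case=> [i|]; last by split=> //; exact: adjoin_gen.
    by case: (He i) => Hi si; split=> //; exact: sub_adjoin.
have [d [H [tH [sH|[I [e [In fe He]]]]]]] := step (size s).+1; last first.
  by have := lin_free_card fe (fun i => (He i).2); rewrite In ltnn.
have [sW H1 HM _] := tower_stable tH.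
exists d; suff -> : setT = H by [].
apply/seteqP; split=> // a _; have [n] := s0P a; apply: in_span_sub => // w.
apply: words_sub => // v /s0s; exact: in_span_sub.
Qed.

End TowerExistence.

(** * The twisted product *)

Lemma coefM_top (R : nzRingType) (p q : {poly R}) m n :
  (size p <= m.+1)%N -> (size q <= n.+1)%N -> (p * q)`_(m + n) = p`_m * q`_n.
Proof.
move=> pm qn; have lm : (m < (m + n).+1)%N by rewrite ltnS leq_addr.
rewrite coefM (bigD1 (Ordinal lm)) //= addKn big1 ?addr0 // => i im.
have [im'|mi|E] := ltngtP i m; last by case/eqP: im; apply/val_inj.
  rewrite [X in _ * X]nth_default ?mulr0 //; apply: leq_trans qn _; lia.
by rewrite nth_default ?mul0r // (leq_trans pm).
Qed.

Section Twisted.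
Variables (K : closedFieldType) (G : affAlgGroup K) (J : hopf2cocycle G).
Local Notation O := (Defs.coord G).
Implicit Types (g h : G) (a b f x : O) (H W : set O) (p q r : {poly O}).

Lemma tmul_interp (s : seq O) : exists l : seq (K * ((G * G) * (G * G))),
  forall a b, a \in s -> b \in s -> tmul J a b =
    \sum_(u <- l) u.1 *: (trans u.2.1.1 u.2.1.2 a * trans u.2.2.1 u.2.2.2 b).
Proof.
have [t [_ tE]] := trans_interp s.
exists [seq (cocycleV J i.1.2 k.1.2 * J i.2.2 k.2.2, ((i.1.1, i.2.1), (k.1.1, k.2.1))) |
  i <- [seq (i, k) | i <- t, k <- t], k <- [seq (i, k) | i <- t, k <- t]].
move=> a b sa sb; rewrite tE // !big_allpairs_dep /=.
by do 2!(apply: eq_bigr => ? _); rewrite big_allpairs_dep.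
Qed.

(** Translates of [a] and [b] remain in [W1] and [W2], so an inclusion known for the ordinary
    product passes to the twisted one. *)
Lemma stable_tmul W1 W2 W3 a b : stable W1 -> stable W2 -> subspace W3 ->
  (forall a b, W1 a -> W2 b -> W3 (a * b)) -> W1 a -> W2 b -> W3 (tmul J a b).
Proof.
move=> st1 st2 s3 W12 Wa Wb; have [l ->] := tmul_interp [:: a; b]; rewrite ?mem_head //; last first.
  by rewrite inE mem_head orbT.
apply: subspace_sum => // u _; apply: subspaceZ => //.
by apply: W12; [exact: st1|exact: st2].
Qed.

(** Elements of [adjoin H x] are always written as ordinary polynomials in [x], and [op] is only
    controlled on top coefficients. The sizes are mere bounds, so these coefficients may be 0. An
    arbitrary [op] allows for the opposite product. *)
Definition leading_law (op : O -> O -> O) H x : Prop := forall p q m n,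
  poly_in H p -> poly_in H q -> (size p <= m.+1)%N -> (size q <= n.+1)%N ->
  exists r, [/\ poly_in H r, (size r <= (m + n).+1)%N, r`_(m + n) = op p`_m q`_n &
    op p.[x] q.[x] = r.[x]].

Lemma tmul_leading H x : stable_subalg H -> (forall g h, H (trans g h x - x)) ->
  leading_law (tmul J) H x.
Proof.
move=> sH Hx p q m n Hp Hq pm qn.
(* The same list [l] must serve for the values at [x] and for the top coefficients: it defines [r]
   and computes its coefficient of degree [m + n]. *)
have [l lE] := tmul_interp [:: p.[x]; q.[x]; p`_m; q`_n].
pose r := \sum_(u <- l) u.1%:A *:
  (poly_trans x u.2.1.1 u.2.1.2 p * poly_trans x u.2.2.1 u.2.2.2 q).
have size_mn (P Q : {poly O}) : (size P <= m.+1)%N -> (size Q <= n.+1)%N -> (size (P * Q)%R <= (m + n).+1)%N.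
  by move=> Pm Qn; apply: leq_trans (size_polyMleq _ _) _; lia.
exists r; split.
- apply: poly_in_sum => // u; apply: poly_in_scale => //; last first.
    by apply: poly_inM => //; exact: poly_in_trans.
  by apply: subalgZ => //; exact: subalg1.
- apply: leq_trans (size_sum _ _ _) _; apply/bigmax_leqP_seq => u _ _.
  apply: leq_trans (size_scale_leq _ _) _.
  by apply: size_mn; exact: size_poly_trans.
- rewrite lE ?inE ?eqxx ?orbT // coef_sum; apply: eq_bigr => u _.
  by rewrite coefZ -scalerAl mul1r coefM_top ?size_poly_trans // !coef_poly_trans.
- rewrite lE ?inE ?eqxx ?orbT // horner_sum; apply: eq_bigr => u _.
  by rewrite hornerZ -scalerAl mul1r hornerM !horner_poly_trans.
Qed.

Lemma leading_law_flip op H x : leading_law op H x -> leading_law (fun a b => op b a) H x.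
Proof.
by move=> L p q m n Hp Hq pm qn; rewrite addnC; apply: L.
Qed.

Definition domain_on H : Prop :=
  forall a b, H a -> H b -> tmul J a b = 0 -> a = 0 \/ b = 0.

(** If a twisted product is 0, the polynomial that represents it is 0 by transcendence of [x], hence
    so is the twisted product of the leading coefficients, which lie one level lower. *)
Lemma tower_domain d H : tower d H -> domain_on H.
Proof.
elim=> [|{}d {}H x tH dH Hx free].
  move=> _ _ [a ->] [b ->]; rewrite tmulZl tmulZr tmul1l scalerA => /eqP.
  rewrite scaler_eq0 oner_eq0 orbF mulf_eq0.
  by case/orP => /eqP->; rewrite scale0r; [left|right].
move=> _ _ [p Hp ->] [q Hq ->] E.
have [->|p0] := eqVneq p 0; first by left; rewrite horner0.
have [->|q0] := eqVneq q 0; first by right; rewrite horner0.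
have [r [Hr _ rmn rE]] := tmul_leading (tower_stable tH) Hx Hp Hq (leqSpred _) (leqSpred _).
move: rmn; rewrite (free r) // -?rE // coef0 -!lead_coefE => /esym.
by case/(dH _ _ (Hp _) (Hq _)) => /eqP; rewrite lead_coef_eq0 ?(negPf p0) ?(negPf q0).
Qed.

(** These are left ideals; right ideals are obtained by flipping [op]. *)
Definition ideal_on (op : O -> O -> O) H (I : set O) : Prop :=
  [/\ I `<=` H, I 0, forall a b, I a -> I b -> I (a + b) &
      forall a b, H a -> I b -> I (op a b)].

Definition noetherian_on (op : O -> O -> O) H : Prop :=
  forall I : nat -> set O, (forall n, ideal_on op H (I n)) ->
    (forall n, I n `<=` I n.+1) -> exists N, forall n, (N <= n)%N -> I n = I N.

(** * Hilbert's basis theorem for a product that obeys a leading law *)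

Section Hilbert.
Variable op : O -> O -> O.
Hypothesis opZ : forall k a, op k%:A a = k *: a.

Lemma noetherian_on_const : noetherian_on op [set f | exists k, f = k%:A].
Proof.
move=> I idI incI.
have mono m n : (m <= n)%N -> I m `<=` I n.
  by move=> /subnK <-; elim: (n - m)%N => // k IH a /IH; exact: incI.
have [[N [a [IN a0]]]|none] := pselect (exists N a, I N a /\ a != 0).
  have full n : (N <= n)%N -> I n = [set f | exists k, f = k%:A].
    move=> /mono Nn; apply/seteqP; have [IH _ _ Iop] := idI n; split=> // _ [k ->].
    have [k0 ak] := IH _ (Nn _ IN); have k0n0 : k0 != 0.
      by apply: contraNneq a0; rewrite ak => ->; rewrite scale0r.
    have -> : k%:A = op (k / k0)%:A a :> O by rewrite opZ ak scalerA mulfVK.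
    by apply: Iop; [exists (k / k0)|exact: Nn].
  by exists N => n Nn; rewrite !full.
exists 0%N => n _; apply/seteqP; split; last exact: mono.
move=> a Ia; have [_ I0 _ _] := idI 0%N.
suff -> : a = 0 by [].
by apply/eqP/negPn/negP => a0; apply: none; exists n, a.
Qed.

Variables (H : set O) (x : O).
Hypotheses (sH : stable_subalg H) (L : leading_law op H x) .
Hypotheses (op1 : forall a, op 1 a = a) .

(** The ideals [lead k n] of coefficients of degree [k] in [I n] increase in both indices. The
    diagonal is constant from [N] on, and the finitely many rows [k < N] are constant from [M0] on.
    From [M] on, the ideals thus have the same top coefficients in every degree, and an element of
    [I n] is reduced to 0 modulo [I M] by lowering its degree. *)
Lemma noetherian_on_adjoin : noetherian_on op H -> noetherian_on op (adjoin H x).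
Proof.
move=> noH I idI incI.
have mono m n : (m <= n)%N -> I m `<=` I n.
  by move=> /subnK <-; elim: (n - m)%N => // k IH a /IH; exact: incI.
pose lead k n := [set c | exists p, [/\ poly_in H p, (size p <= k.+1)%N, p`_k = c & I n p.[x]]].
have lead_ideal k n : ideal_on op H (lead k n).
  have [_ I0 ID Iop] := idI n;
  split=> [_ [p [Hp _ <- _]]//||_ _ [p [Hp sp <- Ip]] [q [Hq sq <- Iq]]|a _ Ha [p [Hp sp <- Ip]]].
  - exists 0; rewrite size_poly0 coef0 horner0; split=> // i; rewrite coef0; exact: subalg0.
  - exists (p + q); rewrite coefD hornerD; split=> //; [exact: poly_inD| |exact: ID].
    by apply: leq_trans (size_polyD _ _) _; rewrite geq_max sp.
  have [r [Hr sr rk rE]] := L (poly_inC sH Ha) Hp (size_polyC_leq1 a) sp.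
  exists r; split=> //; first by rewrite -[k]add0n rk coefC.
  by rewrite -rE hornerC; apply: Iop => //; exact: sub_adjoin.
have lead_mono k n k' n' : (k <= k')%N -> (n <= n')%N -> lead k n `<=` lead k' n'.
  move=> kk' nn' c cL; have {}cL : lead k n' c.
    by have [p [Hp sp pk Ip]] := cL; exists p; split=> //; exact: mono Ip.
  rewrite -(subnK kk'); elim: (k' - k)%N => [//|j [p [Hp sp pk Ip]]].
  (* Multiplication by [x] on the left raises the degree by one and keeps the top coefficient, since
     [op 1 a = a]. *)
  have [r [Hr sr rk rE]] := L (poly_inX sH) Hp (eq_leq (size_polyX _)) sp.
  exists r; split=> //; first by rewrite rk coefX pk op1.
  rewrite -rE hornerX; have [_ _ _ Iop] := idI n'; apply: Iop => //; exact: adjoin_gen.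
have [N diagN] : exists N, forall n, (N <= n)%N -> lead n n = lead N N.
  by apply: noH => n; [exact: lead_ideal|exact: lead_mono].
have [M0 colM] : exists M, forall k n, (k < N)%N -> (M <= n)%N -> lead k n = lead k M.
  have rowk k : exists M, forall n, (M <= n)%N -> lead k n = lead k M.
    by apply: noH => n; [exact: lead_ideal|exact: lead_mono].
  pose M k := projT1 (cid (rowk k)).
  have MP k n : (M k <= n)%N -> lead k n = lead k (M k) by rewrite /M; case: cid => ? /= + ?; exact.
  exists (\max_(k < N) M k)%N => k n kN Mn.
  have le : (M k <= \max_(k < N) M k)%N by exact: (leq_bigmax (Ordinal kN)).
  by rewrite !(MP k) //; exact: leq_trans Mn.
pose M := maxn N M0.
have leadM k n : (M <= n)%N -> lead k n `<=` lead k M.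
  move=> Mn; have [kN|Nk] := ltnP k N.
    by rewrite !(colM k) // ?leq_maxr // (leq_trans _ Mn) // leq_maxr.
  (* For [k >= N], [lead k n] lies in the diagonal term at [maxn k n], which equals [lead N N] and
     so lies in [lead k M]. *)
  have NM : (N <= M)%N by exact: leq_maxl.
  apply: subset_trans (lead_mono N N k M Nk NM); rewrite -(diagN (maxn k n)) ?leq_max ?Nk //.
  by apply: lead_mono; rewrite ?leq_maxl ?leq_maxr.
exists M => n Mn; apply/seteqP; split; last exact: mono.
have ID m a b : I m a -> I m b -> I m (a + b) by case: (idI m) => _ _ + _; apply.
have IN m a : I m a -> I m (- a).
  have [_ _ _ Iop] := idI m => Ia; rewrite -scaleN1r -opZ; apply: Iop => //.
  by apply: sub_adjoin => //; apply: subalgZ => //; exact: subalg1.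
suff main s p : (size p <= s)%N -> poly_in H p -> I n p.[x] -> I M p.[x].
  move=> f If; have [IH _ _ _] := idI n; have [p Hp fE] := IH _ If.
  by rewrite fE in If *; exact: main (leqnn _) Hp If.
elim: s p => [|s IHs] p sp Hp Ip.
  by move: sp; rewrite size_poly_leq0 => /eqP->; rewrite horner0; have [] := idI M.
have /(leadM _ _ Mn)[q [Hq sq qs Iq]] : lead s n p`_s by exists p.
rewrite -[p](subrK q) hornerD; apply: (ID) => //; apply: IHs.
- apply/leq_sizeP => j; rewrite leq_eqVlt => /orP[/eqP<-|sj]; first by rewrite coefB qs subrr.
  by rewrite coefB !nth_default ?subrr //; [exact: leq_trans sj|exact: leq_trans sj].
- exact: poly_inB.
- by rewrite hornerD hornerN; exact: (ID n _ _ Ip (IN _ _ (mono _ _ Mn _ Iq))).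
Qed.

End Hilbert.

Lemma tower_noetherian d H : tower d H ->
  noetherian_on (tmul J) H /\ noetherian_on (fun a b => tmul J b a) H.
Proof.
have Zl k a : tmul J k%:A a = k *: a by rewrite tmulZl tmul1l.
have Zr k a : tmul J a k%:A = k *: a by rewrite tmulZr tmul1r.
elim=> [|{}d {}H x tH [nl nr] Hx _]; first by split; apply: noetherian_on_const.
have sH := tower_stable tH; have L := tmul_leading sH Hx.
split; apply: noetherian_on_adjoin => //.
- by move=> a; exact: tmul1l.
- exact: leading_law_flip.
- by move=> a; exact: tmul1r.
Qed.

End Twisted.

(** * Words, generators and independent twisted monomials *)

Section Words.
Variable A : nzRingType.
Implicit Types s : seq A.

Lemma words1 s n : 1 \in words s n.
Proof. by case: n => [|n]; rewrite /= ?inE ?eqxx. Qed.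

Lemma words_cons s n x w : x \in s -> w \in words s n -> x * w \in words s n.+1.
Proof.
by move=> sx wn; rewrite /= in_cons; apply/orP; right; apply/allpairsP; exists (x, w).
Qed.

Lemma words_inv s n w : w \in words s n.+1 ->
  w = 1 \/ exists x v, [/\ x \in s, v \in words s n & w = x * v].
Proof.
rewrite in_cons => /orP[/eqP|/allpairsP[[x v] [/= sx vn ->]]]; first by left.
by right; exists x, v.
Qed.

Lemma wordsS s n w : w \in words s n -> w \in words s n.+1.
Proof.
elim: n w => [|n IH] w; first by rewrite inE => /eqP->; exact: words1.
case/words_inv=> [->|[a [b [sa wb ->]]]].
  exact: words1.
by apply: words_cons => //; exact: IH.
Qed.

Lemma words_le s m n w : (m <= n)%N -> w \in words s m -> w \in words s n.
Proof. by move=> /subnK <-; elim: (n - m)%N => // k IH /IH; exact: wordsS. Qed.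

Lemma words_mul s m n w w' : w \in words s m -> w' \in words s n -> w * w' \in words s (m + n).
Proof.
elim: m w => [|m IH] w; first by rewrite inE => /eqP->; rewrite mul1r.
case/words_inv=> [->|[a [b [sa wb ->]]]] w'n.
  by rewrite mul1r; apply: words_le w'n; rewrite leq_addl.
by rewrite addSn -mulrA; apply: words_cons => //; exact: IH.
Qed.

Lemma words_exp s n x : x \in s -> x ^+ n \in words s n.
Proof.
move=> sx; elim: n => [|n IH]; first by rewrite expr0 words1.
by rewrite exprS; exact: words_cons.
Qed.

Lemma words_subset s s' n w : {subset s <= s'} -> w \in words s n -> w \in words s' n.
Proof.
move=> ss'; elim: n w => [//|n IH] w.
case/words_inv=> [->|[a [b [sa wb ->]]]].
  exact: words1.
by apply: words_cons; [exact: ss'|exact: IH].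
Qed.

End Words.

Section Generated.
Variables (K : fieldType) (A : algType K).
Implicit Types s : seq A.

Definition generated s : set A := [set a | exists n, in_span (words s n) a].

Lemma generated_words s n w : w \in words s n -> generated s w.
Proof. by exists n; exact: in_span_mem. Qed.

Lemma generated_subspace s : subspace (generated s).
Proof.
split=> [|k a b [m am] [n bn]]; first by exists 0%N; exact: (in_span_subspace _).1.
exists (maxn m n); apply: (in_span_subspace _).2.
  by apply: in_span_trans am => u um; apply/in_span_mem/(words_le _ um)/leq_maxl.
by apply: in_span_trans bn => u un; apply/in_span_mem/(words_le _ un)/leq_maxr.
Qed.

Lemma generated_mul s a b : generated s a -> generated s b -> generated s (a * b).
Proof.
move=> [m am] [n bn]; exists (m + n)%N; have sS := in_span_subspace (words s (m + n)).
apply: (@in_span_sub _ _ (fun a => in_span (words s (m + n)) (a * b)) _ _ _ _ am) => [|u um].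
  split=> [|k u v]; first by rewrite mul0r; exact: sS.1.
  by rewrite mulrDl -scalerAl; exact: sS.2.
apply: (@in_span_sub _ _ (fun b => in_span (words s (m + n)) (u * b)) _ _ _ _ bn) => [|v vn].
  split=> [|k v w]; first by rewrite mulr0; exact: sS.1.
  by rewrite mulrDr -scalerAr; exact: sS.2.
by apply: in_span_mem; exact: words_mul.
Qed.

Lemma generated_subset s s' a : {subset s <= s'} -> generated s a -> generated s' a.
Proof.
move=> ss' [n an]; exists n; apply: in_span_trans an => u un.
exact/in_span_mem/(words_subset ss').
Qed.

End Generated.

Section TwistGenerators.
Variables (K : closedFieldType) (G : affAlgGroup K) (J : hopf2cocycle G).
Local Notation O := (Defs.coord G).
Local Notation A := (twist J).
Implicit Types (g h : G) (H W : set O) (p q r : {poly O}).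

Section Step.
Variables (H : set O) (x : O).
Hypotheses (sH : stable_subalg H) (Hx : forall g h, H (trans g h x - x)).

(** Twisted powers of [x] are monic polynomials of the expected degree in the ordinary powers. *)
Lemma twist_exp_poly n : exists r, [/\ poly_in H r, (size r <= n.+1)%N, r`_n = 1 &
  (x : A) ^+ n = r.[x] :> O].
Proof.
elim: n => [|n [r [Hr sr rn rE]]].
  exists 1; rewrite size_poly1 coef1 hornerC; split=> //.
  by move=> i; rewrite coef1; case: eqP => _; [exact: subalg1|exact: subalg0].
have [r' [Hr' sr' rn' rE']] := tmul_leading J sH Hx (poly_inX sH) Hr (eq_leq (size_polyX _)) sr.
exists r'; split=> //; first by rewrite rn' rn coefX tmul1l.
by rewrite exprS -rE' hornerX -rE.
Qed.

Lemma twist_monom_poly (a : A) n : H a -> exists r, [/\ poly_in H r, (size r <= n.+1)%N, r`_n = a &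
  a * (x : A) ^+ n = r.[x] :> O].
Proof.
move=> Ha; have [r [Hr sr rn rE]] := twist_exp_poly n.
have [r' [Hr' sr' rn' rE']] := tmul_leading J sH Hx (poly_inC sH Ha) Hr (size_polyC_leq1 _) sr.
exists r'; split=> //; first by rewrite -[n]add0n rn' rn coefC tmul1r.
by rewrite -rE' hornerC -rE.
Qed.

(** Induction on the degree: subtracting the twisted monomial with the same top coefficient lowers
    it. *)
Lemma adjoin_generated (s : seq A) : (forall a, H a -> generated s a) ->
  forall a, adjoin H x a -> generated ((x : A) :: s) a.
Proof.
move=> Hs _ [p Hp ->].
have [n] := ubnP (size p); elim: n p Hp => // n IH p Hp; rewrite ltnS => pn.
have [p0|m] := posnP (size p); first by move/eqP: p0; rewrite size_poly_eq0 => /eqP->;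
  rewrite horner0; exact: (generated_subspace _).1.
case: n pn IH => [|n] pn IH; first by rewrite ltnNge pn in m.
have [r [Hr sr rn rE]] := twist_monom_poly n (Hp n).
rewrite -[p](subrK r) hornerD -rE.
apply: (subspaceD (generated_subspace _)).
  apply: IH; first exact: poly_inB.
  rewrite ltnS; apply/leq_sizeP => j; rewrite leq_eqVlt => /orP[/eqP<-|nj].
    by rewrite coefB rn subrr.
  by rewrite coefB !nth_default ?subrr // (leq_trans _ nj).
apply: generated_mul.
  by apply: generated_subset (Hs _ (Hp n)) => u us; rewrite inE us orbT.
apply: (generated_words (n := n)); apply: words_exp; exact: mem_head.
Qed.

Hypothesis free : forall p, poly_in H p -> p.[x] = 0 -> p = 0.

(** Written as an ordinary polynomial in [x], the sum has the last [a j] as its top coefficient,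
    which is 0 by transcendence; then the next one is, and so on. *)
Lemma twist_monom_free n (a : nat -> A) : (forall j, H (a j)) ->
  \sum_(j < n) a j * (x : A) ^+ j = 0 -> forall j, (j < n)%N -> a j = 0.
Proof.
move=> Ha; elim: n => [//|n IH]; rewrite big_ord_recr /= => E.
have [r [Hr sr rE]] : exists r, [/\ poly_in H r, (size r <= n)%N &
    \sum_(j < n) a j * (x : A) ^+ j = r.[x] :> O].
  elim: n {IH E} => [|n [r [Hr sr rE]]].
    exists 0; rewrite size_poly0 big_ord0 horner0; split=> // i; rewrite coef0; exact: subalg0.
  have [r' [Hr' sr' _ rE']] := twist_monom_poly n (Ha n).
  exists (r + r'); rewrite big_ord_recr hornerD /= -rE -rE'; split=> //.
    exact: poly_inD.
  by apply: leq_trans (size_polyD _ _) _; rewrite geq_max sr' andbT leqW.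
have [r' [Hr' sr' rn' rE']] := twist_monom_poly n (Ha n).
have an0 : a n = 0.
  have : r + r' = 0.
    apply: free; first exact: poly_inD.
    by rewrite hornerD -rE -rE'.
  by move=> /(congr1 (fun p : {poly O} => p`_n)); rewrite coefD coef0 rn' nth_default // add0r.
move=> j; rewrite ltnS leq_eqVlt => /orP[/eqP->//|]; apply: IH.
by rewrite an0 mul0r addr0 in E.
Qed.

End Step.

(** The [e i] are the ordered twisted monomials in the [d] variables with all exponents below
    [n]. *)
Lemma tower_words d H : tower d H -> exists s : seq A,
  (forall a, H a -> generated s a) /\
  forall n, exists (I : finType) (e : I -> A),
    [/\ #|I| = (n ^ d)%N, lin_free e & forall i, H (e i) /\ e i \in words s (d * n)].
Proof.
elim=> [|{}d {}H x tH [s [Hs sE]] Hx free].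
  exists [::]; split=> [_ [k ->]|n].
    apply: (subspaceZ _ (generated_subspace _)); apply: (generated_words (n := 0)).
    by rewrite inE.
  exists unit, (fun=> 1); split; first by rewrite card_unit.
    move=> c; rewrite (big_pred1 tt) => [/eqP|[]//].
    by rewrite scaler_eq0 oner_eq0 orbF => /eqP c0 [].
  by move=> i; split; [exists 1; rewrite scale1r|rewrite mul0n inE].
have sH := tower_stable tH.
exists ((x : A) :: s); split=> [|n]; first exact: adjoin_generated.
have [I [e [In fe He]]] := sE n.
exists (prod I 'I_n), (fun i : I * 'I_n => e i.1 * (x : A) ^+ i.2); split.
- by rewrite card_prod card_ord In expnSr.
(* [twist_monom_free] takes a family indexed by all natural numbers, hence the value 0 for [j]
   beyond ['I_n]. *)
- move=> c; pose a j := \sum_i (oapp (fun k => c (i, k)) 0 (insub j)) *: e i.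
  have aE (j : 'I_n) : a j = \sum_i c (i, j) *: e i by rewrite /a valK.
  have Ha j : H (a j).
    by case: sH => sW _ _ _; apply: subspace_sum => // i _; apply: subspaceZ => //; case: (He i).
  have -> : \sum_i c i *: (e i.1 * (x : A) ^+ i.2) = \sum_(j < n) a j * (x : A) ^+ j.
    transitivity (\sum_i \sum_(j < n) c (i, j) *: (e i * (x : A) ^+ j)).
      by rewrite pair_bigA /=; apply: eq_bigr => -[i j] _.
    rewrite exchange_big; apply: eq_bigr => j _; rewrite aE mulr_suml.
    by apply: eq_bigr => i _; rewrite scalerAl.
  move=> /(twist_monom_free sH Hx free Ha) a0 [i j].
  by apply: (fe (fun i => c (i, j))); rewrite -aE; exact: a0.
move=> [i j] /=; case: (He i) => Hi wi; split.
  have [r [Hr _ _ ->]] := twist_monom_poly sH Hx j Hi.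
  by exists r.
rewrite mulSn addnC; apply: words_mul.
  by apply: words_subset wi => u us; rewrite inE us orbT.
by apply: (words_le (ltnW (ltn_ord j))); apply: words_exp; exact: mem_head.
Qed.

End TwistGenerators.

(** * Growth *)

Section Filtrations.
Variables (K : closedFieldType) (G : affAlgGroup K).
Local Notation O := (Defs.coord G).
Implicit Types (g h : G) (a b f x : O) (H W : set O) (p q r : {poly O}).

(** [gfM] is about the ordinary product; together with [gf_stable] it gives the same for any twisted
    product, by [stable_tmul]. *)
Record growth_filtration d H (F : nat -> set O) : Prop := GrowthFiltration {
  gf_subspace : forall m, subspace (F m);
  gf_stable : forall m, stable (F m);
  gf_le : forall m n, (m <= n)%N -> F m `<=` F n;
  gf1 : F 0%N 1;
  gfM : forall m n a b, F m a -> F n b -> F (m + n)%N (a * b);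
  gf_cover : forall a, H a <-> exists m, F m a;
  gf_dim : forall m, exists b : seq O, (size b <= m.+1 ^ d)%N /\ forall a, F m a -> in_span b a
}.

Lemma gf_seq d H F (s : seq O) : growth_filtration d H F ->
  (forall a, a \in s -> H a) -> exists m, forall a, a \in s -> F m a.
Proof.
move=> gF; elim: s => [|a s IH] Hs; first by exists 0%N.
have [|m Fm] := IH; first by move=> b sb; apply: Hs; rewrite inE sb orbT.
have [n Fn] := (gf_cover gF a).1 (Hs a (mem_head _ _)).
exists (maxn m n) => b; rewrite inE => /orP[/eqP->|/Fm Fb].
  exact: (gf_le gF (leq_maxr m n)).
exact: (gf_le gF (leq_maxl m n)).
Qed.

Lemma filtration_const : growth_filtration 0 [set f : O | exists k, f = k%:A]
  (fun=> [set f : O | exists k, f = k%:A]).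
Proof.
have [sW H1 HM HT] := stable_subalg_const G.
split=> [//|//|m n _ a //|//|m n a b|a|m].
- exact: HM.
- by split=> [|[]//]; exists 0%N.
- exists [:: 1]; split=> // _ [k ->]; apply: (subspaceZ _ (in_span_subspace _)).
  exact/in_span_mem/mem_head.
Qed.

(** By interpolation all increments of [x] are combinations of finitely many of them, which lie in a
    common level of the filtration. *)
Lemma trans_sub_bounded H x d F : growth_filtration d H F ->
  (forall g h, H (trans g h x - x)) -> exists w, forall g h, F w (trans g h x - x).
Proof.
move=> gF Hx; have [t [tE _]] := trans_interp [:: x; 1].
have xs : x \in [:: x; 1] by exact: mem_head.
have [|m Fm] := gf_seq (s := [seq trans i.1 k.1 x - x | i <- t, k <- t]) gF.
  by move=> _ /allpairsP[[i k] [_ _ ->]]; exact: Hx.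
have sF := gf_subspace gF m.
exists m => g h.
have -> : trans g h x - x =
    \sum_(i <- t) \sum_(k <- t) (ev g i.2 * ev h k.2) *: (trans i.1 k.1 x - x).
  under [RHS]eq_bigr do (under eq_bigr do rewrite scalerBr; rewrite sumrB).
  rewrite sumrB -tE //; congr (_ - _).
  (* The formula for the function 1, put in the list for this purpose, says that the coefficients
     add up to 1; so [x] can be subtracted inside the sum. *)
  have := tE 1 _ g h; rewrite inE mem_head orbT rmorph1 => /(_ isT) E.
  rewrite -[LHS]mulr1 E mulr_sumr; apply: eq_bigr => i _; rewrite mulr_sumr.
  by apply: eq_bigr => k _; rewrite rmorph1 -scalerAr mulr1.
apply: subspace_sum_seq => // i ti; apply: subspace_sum_seq => // k tk.
by apply: subspaceZ => //; apply: Fm; apply/allpairsP; exists (i, k).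
Qed.

(* x gets a weight w for which all trans g h x - x have degree at most w. *)
Lemma filtration_adjoin d H F x : stable_subalg H -> growth_filtration d H F ->
  (forall g h, H (trans g h x - x)) -> exists F', growth_filtration d.+1 (adjoin H x) F'.
Proof.
move=> sH gF Hx; have [w0 Fw0] := trans_sub_bounded gF Hx.
(* The successor makes the weight positive, so that level [m] only involves powers of [x] up to [m];
   this gives the factor [m.+1] in the dimension bound. *)
pose w := w0.+1.
have Fw g h : F w (trans g h x - x) by exact: (gf_le gF (leqnSn _)).
have FH m a : F m a -> H a by move=> Fa; apply/(gf_cover gF); exists m.
(* The coefficients allowed for [x ^+ j] at level [m]. Subtraction is truncated, so the case
   [m < j * w] is set apart and only allows 0. *)
pose Fx m j := [set c | if (j * w <= m)%N then F (m - j * w)%N c else c = 0].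
have Fxs m j : subspace (Fx m j).
  rewrite /Fx; case: (j * w <= m)%N; first exact: (gf_subspace gF).
  by split=> // k a b -> ->; rewrite scaler0 addr0.
have FxH m j c : Fx m j c -> H c.
  by rewrite /Fx /=; case: ifP => _; [exact: FH|move->; exact: subalg0].
have Fx_le m n j : (m <= n)%N -> Fx m j `<=` Fx n j.
  move=> mn c; rewrite /Fx /=; case: ifP => jm.
    by rewrite (leq_trans jm mn); apply: (gf_le gF); exact: leq_sub2r.
  by move=> ->; case: ifP => // _; exact: (gf_subspace gF _).1.
have FxM m n i j a b : Fx m i a -> Fx n j b -> Fx (m + n)%N (i + j)%N (a * b).
  rewrite /Fx /=; case: ifP => im; last first.
    by move=> -> _; rewrite mul0r; exact: (Fxs _ _).1.
  case: ifP => jn; last by move=> _ ->; rewrite mulr0; exact: (Fxs _ _).1.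
  rewrite mulnDl leq_add // => Fa Fb.
  have -> : (m + n - (i * w + j * w) = (m - i * w) + (n - j * w))%N by lia.
  exact: (gfM gF).
pose F' m := [set f | exists2 p : {poly O}, forall j, Fx m j p`_j & f = p.[x]].
have F'C m c : F m c -> F' m c.
  move=> Fc; exists c%:P; last by rewrite hornerC.
  by case=> [|j]; rewrite coefC /= /Fx /= ?mul0n ?subn0 //; exact: (Fxs _ _).1.
have F's m : subspace (F' m).
  split=> [|k _ _ [p Fp ->] [q Fq ->]].
    by apply: F'C; exact: (gf_subspace gF _).1.
  exists (k%:A *: p + q); last by rewrite hornerD hornerZ -scalerAl mul1r.
  by move=> j; rewrite coefD coefZ -scalerAl mul1r; apply: (Fxs _ _).2.
have F'le m n : (m <= n)%N -> F' m `<=` F' n.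
  by move=> mn _ [p Fp ->]; exists p => // j; exact: Fx_le (Fp j).
have F'M m n a b : F' m a -> F' n b -> F' (m + n)%N (a * b).
  move=> [p Fp ->] [q Fq ->]; exists (p * q); last by rewrite hornerM.
  move=> j; rewrite coefM; apply: subspace_sum => // i _.
  by have := FxM _ _ _ _ _ _ (Fp i) (Fq (j - i)%N); rewrite subnKC // -ltnS.
have F'X : F' w x.
  exists 'X; last by rewrite hornerX.
  move=> j; rewrite coefX; case: eqP => [->|_]; last exact: (Fxs _ _).1.
  by rewrite /Fx /= mul1n leqnn subnn; exact: gf1 gF.
have F'exp y j : F' w y -> F' (j * w)%N (y ^+ j).
  move=> Fy; elim: j => [|j IH]; first by rewrite expr0; apply: F'C; exact: gf1 gF.
  by rewrite exprS mulSn; exact: F'M.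
exists F'; split=> //.
- move=> m g h _ [p Fp ->]; rewrite horner_coef raddf_sum.
  apply: subspace_sum => //= i _; rewrite rmorphM rmorphXn /=.
  have := Fp i; rewrite /Fx /=; case: ifP => im; last first.
    by move=> ->; rewrite raddf0 mul0r; exact: (F's m).1.
  move=> Fpi; rewrite -(subnK im); apply: F'M; first by apply/F'C/(gf_stable gF).
  by apply: F'exp; rewrite -[trans g h x](subrK x); apply: subspaceD => //; exact: F'C.
- exact/F'C/(gf1 gF).
- move=> a; split=> [[p Hp ->]|[m [p Fp ->]]]; last first.
    by exists p => // j; exact: FxH (Fp j).
  have [|m Fm] := gf_seq (s := p : seq O) gF.
    by move=> c /(nthP 0)[j _ <-]; exact: Hp.
  exists (m + size p * w)%N, p => // j.
  have [jp|pj] := ltnP j (size p); last by rewrite nth_default //; exact: (Fxs _ _).1.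
  have jw : (j * w <= size p * w)%N by rewrite leq_mul2r (ltnW jp) orbT.
  rewrite /Fx /= (leq_trans jw (leq_addl _ _)).
  by apply: (gf_le gF _ (Fm _ (mem_nth 0 jp))); rewrite -addnBA // leq_addr.
move=> m; have [b [sb bP]] := gf_dim gF m.
exists [seq c * x ^+ j | c <- b, j <- iota 0 m.+1]; split.
  by rewrite size_allpairs size_iota expnSr leq_mul2r sb orbT.
move=> _ [p Fp ->]; rewrite (@horner_coef_wide _ m.+1); last first.
  apply/leq_sizeP => j mj; have := Fp j; rewrite /Fx /= ifN // -ltnNge.
  by apply: leq_trans mj _; rewrite leq_pmulr.
apply: (subspace_sum _ (in_span_subspace _)) => i _.
have : in_span b p`_i.
  apply: bP; have := Fp i; rewrite /Fx /=; case: ifP => _.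
    by apply: (gf_le gF); exact: leq_subr.
  by move=> ->; exact: (gf_subspace gF _).1.
have sS := in_span_subspace [seq c * x ^+ j | c <- b, j <- iota 0 m.+1].
apply: (@in_span_sub _ _ (fun c => in_span _ (c * x ^+ i))) => [|c cb].
  split=> [|k u v]; first by rewrite mul0r; exact: sS.1.
  by rewrite mulrDl -scalerAl; exact: sS.2.
by apply/in_span_mem/allpairs_f => //; rewrite mem_iota add0n /= ltn_ord.
Qed.

Lemma tower_filtration d H : tower d H -> exists F, growth_filtration d H F.
Proof.
elim=> [|{}d {}H x tH [F gF] Hx _]; first by eexists; exact: filtration_const.
exact: filtration_adjoin (tower_stable tH) gF Hx.
Qed.

End Filtrations.

(** * Logarithmic growth and the Gelfand-Kirillov dimension *)

Section LogGrowth.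
Variable R : realType.

Lemma ln_natr_unbounded (M : R) : exists N, forall n, (N <= n)%N -> M <= ln n%:R.
Proof.
exists (Num.truncn (expR M)).+1 => n Nn.
have Mn : expR M < n%:R.
  by apply: lt_le_trans (truncnS_gt _) _; rewrite ler_nat.
by rewrite -[M]expRK ler_ln ?posrE ?expR_gt0 ?(lt_trans _ Mn) ?expR_gt0 // ltW.
Qed.

Lemma limn_esup_ln_le (x : nat -> nat) (d c : nat) :
  (forall n, (0 < x n)%N) -> (forall n, (x n <= (c * n).+1 ^ d)%N) ->
  (limn_esup (fun n => (ln (x n)%:R / ln n%:R : R)%:E) <= d%:R%:E)%E.
Proof.
move=> x0 xle; apply/lee_addgt0Pr => e e0.
(* The bound 1 keeps [ln n] positive for the division; the other one absorbs the constant
   [d * ln c.+1] into [e * ln n]. *)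
have [N NP] := ln_natr_unbounded (Num.max 1 (d%:R * ln c.+1%:R / e)).
apply: (@le_trans _ _ (ereal_sup ((fun n => (ln (x n)%:R / ln n%:R : R)%:E) @` [set n | (maxn N 1 <= n)%N]))).
  by apply: ereal_inf_lbound => /=; exists [set n | (maxn N 1 <= n)%N] => //; exists (maxn N 1).
apply: ge_ereal_sup => _ [n /= + <-]; rewrite geq_max => /andP[Nn n1].
have := NP n Nn; rewrite ge_max => /andP[l1 le].
have l0 : 0 < ln n%:R :> R by exact: lt_le_trans l1.
rewrite -EFinD lee_fin ler_pdivrMr //.
apply: (@le_trans _ _ (ln ((c.+1 * n) ^ d)%:R)).
  rewrite ler_ln ?posrE ?ltr0n ?x0 ?expn_gt0 ?muln_gt0 ?n1 // ler_nat.
  apply: leq_trans (xle n) _; case: (d) => // d'.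
  by rewrite leq_exp2r // mulSn -add1n leq_add2r.
rewrite natrX natrM lnXn ?mulr_gt0 ?ltr0n // lnM ?posrE ?ltr0n // -[(_ + _) *+ d]mulr_natl.
by rewrite mulrDr mulrDl addrC lerD2l [e * _]mulrC -ler_pdivrMr.
Qed.

(** It suffices to look at indices [c * n]: they are arbitrarily large, and there the ratio is at
    least [d - e] once [d * ln c] is at most [e * ln (c * n)]. *)
Lemma limn_esup_ln_ge (x : nat -> nat) (d c : nat) :
  (0 < c)%N -> (forall n, (n ^ d <= x (c * n))%N) ->
  (d%:R%:E <= limn_esup (fun n => (ln (x n)%:R / ln n%:R : R)%:E))%E.
Proof.
move=> c0 xge; apply: le_ereal_inf_tmp => _ [V [M _ MV] <-].
apply/lee_subgt0Pr => e e0.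
have [N NP] := ln_natr_unbounded (Num.max 1 (d%:R * ln c%:R / e)).
pose n := maxn (maxn M N) 1; have n0 : (0 < n)%N by rewrite leq_maxr.
have ncn : (n <= c * n)%N by rewrite leq_pmull.
have Mn : (M <= n)%N by rewrite !leq_max leqnn.
have Nn : (N <= n)%N by rewrite !leq_max leqnn orbT.
have := NP _ (leq_trans Nn ncn); rewrite ge_max => /andP[l1 le].
have l0 : 0 < ln (c * n)%:R :> R by exact: lt_le_trans l1.
apply: le_trans (ereal_sup_ubound _); last first.
  by exists (c * n)%N => //; apply: MV => /=; exact: leq_trans Mn ncn.
rewrite -EFinB lee_fin ler_pdivlMr //.
apply: (@le_trans _ _ (ln (n ^ d)%:R)); last first.
  by rewrite ler_ln ?posrE ?ltr0n ?expn_gt0 ?n0 ?(leq_trans _ (xge n)) ?expn_gt0 ?n0 // ler_nat.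
rewrite natrX lnXn ?ltr0n // -[ln _ *+ d]mulr_natl mulrBl lerBlDr.
rewrite {1}natrM lnM ?posrE ?ltr0n // mulrDr addrC lerD2l.
by rewrite [e * _]mulrC -ler_pdivrMr.
Qed.

End LogGrowth.

Section GelfandKirillov.
Variables (R : realType) (K : closedFieldType) (G : affAlgGroup K) (J : hopf2cocycle G).
Local Notation A := (twist J).

Lemma words_filtration d H F c (s : seq A) n w : growth_filtration d H F ->
  (forall a, a \in s -> F c (a : Defs.coord G)) -> w \in words s n -> F (c * n)%N (w : Defs.coord G).
Proof.
move=> gF sF; elim: n w => [|n IH] w.
  by rewrite inE => /eqP->; rewrite muln0; exact: (gf1 gF).
case/words_inv => [->|[a [v [sa vn ->]]]]; first exact: (gf_le gF (leq0n _)) _ (gf1 gF).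
rewrite mulnS; apply: (@stable_tmul _ _ J (F c) (F (c * n)%N)).
- exact: (gf_stable gF).
- exact: (gf_stable gF).
- exact: (gf_subspace gF).
- by move=> ? ?; exact: (gfM gF).
- exact: sF.
- exact: IH.
Qed.

Lemma GKdim_twist d : tower d (@setT (Defs.coord G)) -> GKdim R A = d%:R%:E.
Proof.
move=> tG; apply/eqP; rewrite eq_le; apply/andP; split.
  have [F gF] := tower_filtration tG.
  apply: ge_ereal_sup => _ [s _ <-].
  have [c cF] : exists c, forall a, a \in (s : seq (Defs.coord G)) -> F c a.
    by apply: (gf_seq gF).
  apply: (@limn_esup_ln_le _ _ _ c) => n.
    rewrite -card_unit; apply: (span_dim_ge (v := fun=> 1)).
      move=> k; rewrite (big_pred1 tt) => [/eqP|[]//].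
      by rewrite scaler_eq0 oner_eq0 orbF => /eqP k0 [].
    by move=> _; exact/in_span_mem/words1.
  have [b [sb bF]] := gf_dim gF (c * n).
  apply: leq_trans sb; apply: span_dim_le => w wn.
  by apply: bF; apply: words_filtration gF _ wn; exact: cF.
have [s [_ sP]] := tower_words J tG.
apply: le_trans (ereal_sup_ubound _); last by exists s.
(* The independent words have length at most [d * n]; [maxn d 1] keeps the factor positive when [d]
   is 0. *)
apply: (@limn_esup_ln_ge _ _ _ (maxn d 1)); first by rewrite leq_maxr.
move=> n; have [I [e [<- fe eP]]] := sP n; apply: span_dim_ge fe _ => i.
case: (eP i) => _ ei; apply/in_span_mem/(words_le _ ei).
by rewrite leq_mul2r leq_maxl orbT.
Qed.

End GelfandKirillov.

(** * The Zariski dimension *)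

Section Coordinates.
Variables (K : closedFieldType) (G : affAlgGroup K).
Local Notation O := (Defs.coord G).
Implicit Types (a b f x : O) (H W : set O) (p q r : {poly O}).

(** Characters of the subalgebra [H], encoded as total functions whose values outside [H] are
    arbitrary. *)
Definition hom_on H (phi : O -> K) : Prop :=
  [/\ phi 1 = 1, forall k a b, H a -> H b -> phi (k *: a + b) = k * phi a + phi b &
      forall a b, H a -> H b -> phi (a * b) = phi a * phi b].

(** Since [x] is transcendental over [H], a character extends with any prescribed value at [x]. *)
Lemma hom_on_adjoin H x (phi : O -> K) (c : K) : stable_subalg H ->
  (forall p, poly_in H p -> p.[x] = 0 -> p = 0) -> hom_on H phi ->
  exists psi, [/\ hom_on (adjoin H x) psi, forall a, H a -> psi a = phi a & psi x = c].
Proof.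
move=> sH free [phi1 phiL phiM]; have H0 := subalg0 sH.
have phi0 : phi 0 = 0.
  by apply: (@addrI _ (phi 0)); rewrite addr0 -{1}[phi 0]mul1r -phiL // scaler0 addr0.
have phi_sum I (r : seq I) (F : I -> O) : (forall i, H (F i)) ->
    phi (\sum_(i <- r) F i) = \sum_(i <- r) phi (F i).
  move=> HF; elim: r => [|i r IH]; first by rewrite !big_nil.
  rewrite !big_cons -[F i]scale1r phiL ?scale1r ?IH ?mul1r //.
  by case: sH => sW _ _ _; apply: subspace_sum.
have coefm p i : (map_poly phi p)`_i = phi p`_i by rewrite coef_map_id0.
(* The polynomial that represents [f], unique by [free], with default 0 outside [adjoin H x]. *)
pose rep f := if pselect (exists2 p, poly_in H p & f = p.[x]) is left e
  then projT1 (cid2 e) else 0.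
have repE p : poly_in H p -> rep p.[x] = p.
  move=> Hp; rewrite /rep; case: pselect => [e|[]]; last by exists p.
  case: cid2 => q /= Hq /eqP; rewrite eq_sym -subr_eq0 -hornerN -hornerD => /eqP.
  by move/(free _ (poly_inB sH Hq Hp))/eqP; rewrite subr_eq0 => /eqP.
pose psi f := (map_poly phi (rep f)).[c].
have psiE p : poly_in H p -> psi p.[x] = (map_poly phi p).[c].
  by move=> Hp; rewrite /psi repE.
have H1 := subalg1 sH.
have psiC a : H a -> psi a = phi a.
  move=> Ha; rewrite -[in LHS](hornerC a x) psiE; last exact: poly_inC.
  have -> : map_poly phi a%:P = (phi a)%:P.
    by apply/polyP => i; rewrite coefm !coefC; case: ifP.
  by rewrite hornerC.
exists psi; split=> //; last first.
  rewrite -[in LHS](hornerX x) psiE; last exact: poly_inX.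
  have -> : map_poly phi 'X = 'X.
    by apply/polyP => i; rewrite coefm !coefX; case: (i == 1)%N.
  by rewrite hornerX.
split; first by rewrite psiC.
- move=> k _ _ [p Hp ->] [q Hq ->].
  have E : k *: p.[x] + q.[x] = (k%:A *: p + q).[x].
    by rewrite hornerD hornerZ -scalerAl mul1r.
  rewrite E !psiE //; last first.
    by apply: poly_inD => //; apply: poly_in_scale => //; exact: subalgZ.
  rewrite -hornerZ -hornerD; congr (_.[c]); apply/polyP => i.
  by rewrite coefD coefZ !coefm coefD coefZ -scalerAl mul1r phiL.
- move=> _ _ [p Hp ->] [q Hq ->]; rewrite -hornerM !psiE //; last exact: poly_inM.
  rewrite -hornerM; congr (_.[c]); apply/polyP => i.
  rewrite coefm !coefM phi_sum; last by move=> j; exact: subalgM.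
  by apply: eq_bigr => j _; rewrite !coefm phiM.
Qed.

(** The [xs] are the variables of the tower. Characters take arbitrary values on them, and the last
    clause, an induction principle, says that they generate [H]. *)
Lemma tower_coordinates d H : tower d H -> exists xs : nat -> O,
  [/\ forall i, (i < d)%N -> H (xs i),
      forall c : nat -> K, exists2 phi, hom_on H phi & forall i, (i < d)%N -> phi (xs i) = c i &
      forall W, subspace W -> W 1 -> (forall a b, W a -> W b -> W (a * b)) ->
        (forall i, (i < d)%N -> W (xs i)) -> H `<=` W].
Proof.
elim=> [|{}d {}H x tH [xs [Hxs xsP genP]] Hx free].
  exists (fun=> 0); split=> // [c|W sW W1 _ _ _ [k ->]]; last exact: subspaceZ.
  exists (fun a => ev 1%g a) => //; split=> *; [exact: ev1|by rewrite evD evZ|exact: evM].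
have sH := tower_stable tH.
exists (fun i => if (i < d)%N then xs i else x); split=> [i _|c|W sW W1 WM Wxs].
- case: ltnP => [/Hxs|_]; [exact: sub_adjoin|exact: adjoin_gen].
- have [phi hphi phic] := xsP c.
  have [psi [hpsi psiH psix]] := hom_on_adjoin (c d) sH free hphi.
  exists psi => // i; rewrite ltnS leq_eqVlt => /orP[/eqP->|id]; first by rewrite ltnn.
  by rewrite id psiH ?phic //; exact: Hxs.
have HW : H `<=` W.
  by apply: genP => // i id; have := Wxs i (leqW id); rewrite id.
have Wx : W x by have := Wxs d (ltnSn d); rewrite ltnn.
move=> _ [p Hp ->]; rewrite horner_coef; apply: subspace_sum => // i _.
apply: (WM); first exact: HW.
by elim: (i : nat) => [|j IH]; rewrite ?expr0 // exprS; apply: (WM).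
Qed.

Lemma hom_on_point (phi : O -> K) : hom_on setT phi -> exists g : G, forall f, phi f = ev g f.
Proof.
move=> [phi1 phiL phiM].
have lphi : linear (phi : O -> K^o) by move=> k a b; exact: phiL.
have mphi : monoid_morphism (phi : O -> K^o) by split=> // a b; exact: phiM.
pose F : {lrmorphism O -> K^o} := HB.pack (phi : O -> K^o)
  (GRing.isLinear.Build K O K^o *:%R phi lphi) (GRing.isMonoidMorphism.Build O K^o phi mphi).
have [g gE] := ev_surj F.
by exists g => f; rewrite -gE.
Qed.

End Coordinates.

Section ZariskiDimension.
Variables (K : closedFieldType) (G : affAlgGroup K).
Local Notation O := (Defs.coord G).
Implicit Types (Z : set G) (f a : O).

Definition vanish Z f : Prop := forall g, Z g -> ev g f = 0.

Lemma vanish_prime Z f1 f2 : irreducible_closed Z -> vanish Z (f1 * f2) ->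
  vanish Z f1 \/ vanish Z f2.
Proof.
move=> [_ _ irr] v12.
have cl f : zariski_closed [set g | ev g f = 0].
  exists [set f]; apply/seteqP; split=> g /= H; first by move=> _ ->.
  exact: H.
have [|v|v] := irr _ _ (cl f1) (cl f2); last 2 first.
- by left=> g /v.
- by right=> g /v.
move=> g /v12; rewrite evM => /eqP; rewrite mulf_eq0.
by case/orP => /eqP ?; [left|right].
Qed.

Lemma vanish_proper Z Z' : zariski_closed Z -> Z `<` Z' ->
  exists2 f, vanish Z f & ~ vanish Z' f.
Proof.
move=> [S ZE] [ZZ' nZ'Z].
have [g Z'g nZg] : exists2 g, Z' g & ~ Z g.
  apply: contrapT => nex; apply: nZ'Z => g Z'g; apply: contrapT => nZg; apply: nex.
  by exists g.
have [f Sf fg] : exists2 f, S f & ev g f <> 0.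
  apply: contrapT => nex; apply: nZg; rewrite ZE => f Sf; apply: contrapT => fg; apply: nex.
  by exists f.
exists f; first by move=> h; rewrite ZE => /(_ f Sf).
by move=> /(_ g Z'g).
Qed.

(** Linear independence of the classes of the [e i] modulo the ideal of [Z]. *)
Definition free_mod Z (I : finType) (e : I -> O) : Prop :=
  forall c : I -> K, vanish Z (\sum_i c i *: e i) -> forall i, c i = 0.

(** Consider a combination of powers of [a] that vanishes on [Z']. On [Z] only its constant term
    survives, so that term is 0. What remains is a multiple of [a], which can be divided by [a]
    because the ideal of [Z'] is prime and does not contain [a]. *)
Lemma free_mod_step Z Z' a n (I : finType) (e : I -> O) :
  irreducible_closed Z' -> Z `<=` Z' -> vanish Z a -> ~ vanish Z' a ->
  free_mod Z e -> free_mod Z' (fun p : I * 'I_n => e p.1 * a ^+ p.2).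
Proof.
move=> irr ZZ' va nva fe.
have main m (P : nat -> O) : (forall j, vanish Z (P j) -> P j = 0) ->
    vanish Z' (\sum_(j < m) P j * a ^+ j) -> forall j, (j < m)%N -> P j = 0.
  elim: m P => [//|m IH] P HP.
  have -> : \sum_(j < m.+1) P j * a ^+ j = P 0%N + a * \sum_(j < m) P j.+1 * a ^+ j.
    rewrite big_ord_recl expr0 mulr1; congr (_ + _); rewrite mulr_sumr.
    by apply: eq_bigr => j _; rewrite exprS mulrCA.
  move=> vP; have P0 : P 0%N = 0.
    apply: HP => g Zg; have := vP g (ZZ' g Zg).
    by rewrite evD evM va // mul0r addr0.
  move: vP; rewrite P0 add0r => /(vanish_prime irr)[//|vP] [|j] //.
  by rewrite ltnS; apply: (IH (fun j => P j.+1)) => // i; exact: HP.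
move=> c; pose P j := \sum_i (oapp (fun k => c (i, k)) 0 (insub j)) *: e i.
have PE (j : 'I_n) : P j = \sum_i c (i, j) *: e i by rewrite /P valK.
have -> : \sum_i c i *: (e i.1 * a ^+ i.2) = \sum_(j < n) P j * a ^+ j.
  transitivity (\sum_i \sum_(j < n) c (i, j) *: (e i * a ^+ j)).
    by rewrite pair_bigA /=; apply: eq_bigr => -[i j] _.
  rewrite exchange_big; apply: eq_bigr => j _; rewrite PE mulr_suml.
  by apply: eq_bigr => i _; rewrite scalerAl.
move=> /main H [i j]; apply: (fe (fun i => c (i, j))); rewrite -PE H //.
  by move=> g _; rewrite ev0.
move=> m Pm; have c0 := fe (fun i => oapp (fun k => c (i, k)) 0 (insub m)) Pm.
by apply: big1 => l _; rewrite c0 scale0r.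
Qed.

(** The [e i] are the monomials with exponents below [n] in [k] functions, one for each strict
    inclusion, vanishing on the smaller set but not on the larger; [c] is the sum of their
    filtration degrees. *)
Lemma chain_free_mod d H F k (Z : nat -> set G) : growth_filtration d H F -> H = setT ->
  (forall i, (i <= k)%N -> irreducible_closed (Z i)) ->
  (forall i, (i < k)%N -> Z i `<` Z i.+1) -> exists c, forall n, exists (I : finType) (e : I -> O),
    [/\ #|I| = (n ^ k)%N, free_mod (Z k) e & forall i, F (c * n)%N (e i)].
Proof.
move=> gF HT; elim: k => [|k IH] irr lt.
  exists 0%N => n; exists unit, (fun=> 1); split; first by rewrite card_unit.
    have [_ [g Zg] _] := irr 0%N isT; move=> c /(_ g Zg).
    by rewrite (big_pred1 tt) => [|[]//]; rewrite evZ ev1 mulr1 => c0 [].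
  by move=> _; rewrite mul0n; exact: (gf1 gF).
have [|i ik|c cP] := IH; first by move=> i ik; apply: irr; exact: leqW.
  by apply: lt; exact: leqW.
have irrk := irr k.+1 (leqnn _).
have [[clk _ _] ltk] := (irr k (leqnSn k), lt k (leqnn _)).
have [a va nva] := vanish_proper clk ltk.
have [w Fa] : exists w, F w a by apply/(gf_cover gF); rewrite HT.
exists (c + w)%N => n; have [I [e [In fe Fe]]] := cP n.
exists (prod I 'I_n), (fun p : I * 'I_n => e p.1 * a ^+ p.2); split.
- by rewrite card_prod card_ord In expnSr.
- by apply: free_mod_step fe => //; case: ltk.
move=> [i j] /=; rewrite mulnDl; apply: (gfM gF) => //.
apply: (gf_le gF (_ : (w * j <= w * n)%N)); first by rewrite leq_mul2l (ltnW (ltn_ord j)) orbT.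
elim: (j : nat) => [|m IHm]; first by rewrite expr0 muln0; exact: (gf1 gF).
by rewrite exprS mulnS; exact: (gfM gF).
Qed.

Lemma expn_growth k d c : (forall n, n ^ k <= (c * n).+1 ^ d)%N -> (k <= d)%N.
Proof.
move=> H; rewrite leqNgt; apply/negP => dk.
(* If [d < k], then [n ^ d.+1 <= (c.+1 * n) ^ d] for positive [n], so [n] is at most [c.+1 ^ d];
   this [n] is the first value that is too large. *)
pose n := (c.+1 ^ d).+1.
have : (n * n ^ d <= c.+1 ^ d * n ^ d)%N.
  rewrite -expnS -expnMn; apply: (@leq_trans (n ^ k)); first by rewrite leq_pexp2l.
  apply: leq_trans (H n) _; case: (d) => // d'.
  by rewrite leq_exp2r // mulSn -add1n leq_add2r.
by rewrite leq_mul2r expn_eq0 /= ltnn.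
Qed.

(** In the coordinates [xs] the group is an affine space of dimension [d], and [Z k] is the linear
    subspace on which the first [d - k] coordinates vanish. *)
Lemma tower_chain d : tower d (@setT O) -> exists Z : nat -> set G,
  (forall i, (i <= d)%N -> irreducible_closed (Z i)) /\
  (forall i, (i < d)%N -> Z i `<` Z i.+1).
Proof.
move=> tG; have [xs [_ xsP genP]] := tower_coordinates tG.
have point (c : nat -> K) : exists g : G, forall i, (i < d)%N -> ev g (xs i) = c i.
  have [phi hphi phic] := xsP c; have [g gE] := hom_on_point hphi.
  by exists g => i id; rewrite -gE phic.
pose Z k := [set g : G | forall i, (i < d - k)%N -> ev g (xs i) = 0].
have clZ k : zariski_closed (Z k).
  exists [set f | exists2 i, (i < d - k)%N & f = xs i]; apply/seteqP; split=> g /= H.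
    by move=> _ [i ik ->]; exact: H.
  by move=> i ik; apply: H; exists i.
exists Z; split=> [k _|k kd]; last first.
  split; first by move=> g Zg i ik; apply: Zg; lia.
  have [g gE] := point (fun i => (i == d - k.+1)%N%:R).
  have Zg : Z k.+1 g by move=> i ik; rewrite gE; [rewrite ltn_eqF|lia].
  have lt1 : (d - k.+1 < d - k)%N by lia.
  have lt2 : (d - k.+1 < d)%N by lia.
  move=> /(_ g Zg _ lt1); rewrite gE // eqxx => /eqP.
  by rewrite oner_eq0.
split; first exact: clZ.
  by have [g gE] := point (fun=> 0); exists g => i ik; apply: gE; lia.
move=> Z1 Z2 [S1 Z1E] [S2 Z2E] ZZ12; apply: contrapT => /not_orP[n1 n2].
have pick S Z' : Z' = [set g : G | forall f, S f -> ev g f = 0] -> ~ Z k `<=` Z' ->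
    exists g f, [/\ Z k g, S f & ev g f != 0].
  move=> Z'E nZ; apply: contrapT => nex; apply: nZ => g Zg; rewrite Z'E => f Sf.
  by apply: contrapT => /eqP fg; apply: nex; exists g, f.
have [g1 [f1 [Zg1 Sf1 fg1]]] := pick _ _ Z1E n1.
have [g2 [f2 [Zg2 Sf2 fg2]]] := pick _ _ Z2E n2.
(* the line through g1 and g2 in the coordinates xs *)
pose L (t : K) := projT1 (cid (point (fun i => ev g1 (xs i) + t * (ev g2 (xs i) - ev g1 (xs i))))).
have LE t i : (i < d)%N -> ev (L t) (xs i) = ev g1 (xs i) + t * (ev g2 (xs i) - ev g1 (xs i)) :> K.
  by rewrite /L; case: cid => g /= + id; exact.
have LP f : exists P : {poly K}, forall t, ev (L t) f = P.[t].
  apply: (genP (fun f => exists P : {poly K}, forall t, ev (L t) f = P.[t])) => //.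
  - split=> [|c a b [P PE] [Q QE]]; first by exists 0 => t; rewrite ev0 horner0.
    by exists (c *: P + Q) => t; rewrite evD evZ PE QE hornerD hornerZ.
  - by exists 1 => t; rewrite ev1 hornerC.
  - by move=> a b [P PE] [Q QE]; exists (P * Q) => t; rewrite evM PE QE hornerM.
  move=> i id; exists ((ev g1 (xs i))%:P + 'X * (ev g2 (xs i) - ev g1 (xs i))%:P) => t.
  by rewrite LE // !hornerE.
have ext g g' f : (forall i, (i < d)%N -> ev g (xs i) = ev g' (xs i)) -> ev g f = ev g' f.
  move=> gg'; apply: (genP (fun f => ev g f = ev g' f)) => //.
  - by split=> [|c a b ga gb]; rewrite ?ev0 // !evD !evZ ga gb.
  - by rewrite !ev1.
  - by move=> a b ga gb; rewrite !evM ga gb.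
have [[P1 P1E] [P2 P2E]] := (LP f1, LP f2).
(* [P1] is nonzero at 0 and [P2] at 1, where the line meets [g1] and [g2]. A non-root of the product
   gives a point of [Z k] outside both [Z1] and [Z2]. *)
have [t] : exists t, ~~ root (P1 * P2) t.
  apply/closed_nonrootP; rewrite mulf_neq0 //.
    apply: contraNneq fg1 => P10; rewrite -(ext (L 0)) ?P1E ?P10 ?horner0 //.
    by move=> i id; rewrite LE // mul0r addr0.
  apply: contraNneq fg2 => P20; rewrite -(ext (L 1)) ?P2E ?P20 ?horner0 //.
  by move=> i id; rewrite LE // mul1r addrC subrK.
rewrite rootM negb_or /root -P1E -P2E => /andP[t1 t2].
have /ZZ12[|] : Z k (L t).
- by move=> i ik; rewrite LE ?Zg1 ?Zg2 ?subrr ?mulr0 ?addr0 //; lia.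
- by rewrite Z1E => /(_ f1 Sf1)/eqP; rewrite (negPf t1).
- by rewrite Z2E => /(_ f2 Sf2)/eqP; rewrite (negPf t2).
Qed.

Lemma zariski_dim_tower (R : realType) d : tower d (@setT O) -> zariski_dim G R = d%:R%:E.
Proof.
move=> tG; apply/eqP; rewrite eq_le; apply/andP; split; last first.
  by apply: ereal_sup_ubound; exists d => //; exact: tower_chain.
apply: ge_ereal_sup => _ [k [Z [irr lt]] <-]; rewrite lee_fin ler_nat.
have [F gF] := tower_filtration tG.
have [c cP] := chain_free_mod gF erefl irr lt.
apply: (@expn_growth _ _ c) => n; have [I [e [<- fe Fe]]] := cP n.
have [b [sb bF]] := gf_dim gF (c * n); apply: leq_trans sb.
apply: (@lin_free_card _ _ _ e) => [u u0|i]; last exact: bF.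
by apply: fe => g _; rewrite u0 ev0.
Qed.

End ZariskiDimension.

Theorem corollary3p2 (R : realType) (G : affAlgGroup R[i]) (J : hopf2cocycle G) :
  unipotent G ->
  [/\ finitely_generated (twist J), noetherian (twist J), is_domain (twist J)
    & GKdim R (twist J) = zariski_dim G R].
Proof.
move=> uG; have [d tG] := tower_exists (pchar_num _) uG.
have [nl nr] := tower_noetherian J tG.
split.
- by have [s [sP _]] := tower_words J tG; exists s => a; exact: sP.
- split=> I idI incI; [apply: (nl I) => // n|apply: (nr I) => // n];
    by have [I0 ID IM] := idI n; split=> // a b _; exact: IM.
- by move=> a b; exact: (tower_domain tG).
- by rewrite (GKdim_twist R J tG) (zariski_dim_tower R tG).
Qed.
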